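(* Let $(E,\mathcal{B})$ be a bornological $k$-vector space of convex type. The following are equivalent: (i) $(E,\mathcal{B})=(E,\tau)^{\mathrm b}$ for some Hausdorff LB-space $(E,\tau)$. (ii) There exist a sequence of Banach disks $(\widehat{B}_n)_{n\in\mathbb{N}}$ in $(E,\mathcal{B})$ and a sequence of pre-Banach disks $(B_n)_{n\in\mathbb{N}}$ in $(E,\mathcal{B})$ such that $$E=\bigcup_{n\in\mathbb{N}}E_{\widehat{B}_n}\quad\text{and}\quad (E,\mathcal{B})=\operatorname{colim}_{n\in\mathbb{N}}(E_{B_n},\|\cdot\|_{B_n})^{\mathrm b},$$ and such that $(B_n)_{n\in\mathbb{N}}$ satisfies both of the following conditions: (I) for every $e\in E$ with $e\neq 0$ there exists a linear map $e'\colon E\to k$ such that $e'(e)\neq 0$ and $\sup_{b\in B_n}|e'(b)|<\infty$ for all $n\in\mathbb{N}$; (II) for every $n\in\mathbb{N}$ there exists $m\geqslant n$ such that the closure $\overline{B_n}$ of $B_n$ in $(E,\mathcal{B})^{\mathrm t}$ is bounded in $(E_{B_m},\|\cdot\|_{B_m})^{\mathrm b}$ (in particular contained in $E_{B_m}$).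
   Context: Let $k\in\{\mathbb{R},\mathbb{C}\}$. A bornological $k$-vector space of convex type (bvs) is a $k$-vector space $E$ with a family $\mathcal{B}$ of subsets (''bounded sets'') that covers $E$ and is closed under subsets, finite unions, sums, scalar multiples and absolutely convex hulls; morphisms are the linear maps sending bounded sets to bounded sets. $\mathbf{Born}$ is the category of bvs. $\mathbf{Tc}$ is the category of (possibly non-Hausdorff) locally convex topological $k$-vector spaces (lcs) and continuous linear maps. The functor $(\cdot)^{\mathrm b}\colon\mathbf{Tc}\to\mathbf{Born}$ equips $(E,\tau)$ with all its $\tau$-bounded sets; $(\cdot)^{\mathrm t}\colon\mathbf{Born}\to\mathbf{Tc}$ equips $(E,\mathcal{B})$ with the topology having as basis of $0$-neighbourhoods all absolutely convex bornivorous sets (those absorbing every $B\in\mathcal{B}$). (Semi-)normed spaces are regarded as lcs. An LB-space is an lcs $(E,\tau)\cong\operatorname{colim}_{n\in\mathbb{N}}(E_n,\|\cdot\|_n)$ (colimit in $\mathbf{Tc}$) for some sequence of Banach spaces $(E_1,\|\cdot\|_1)\to(E_2,\|\cdot\|_2)\to\cdots$ with injective continuous linear linking maps. For a non-empty absolutely convex subset $B$ of a vector space $E$, let $E_B=\operatorname{span}B$ with the Minkowski functional $\|e\|_B=\inf\{\lambda>0: e\in\lambda B\}$. $B$ is a norming disk in $E$ if $(E_B,\|\cdot\|_B)$ is a normed space and a Banach disk in $E$ if it is a Banach space. A Banach disk in $(E,\mathcal{B})$ is a Banach disk $B$ in $E$ with $B\in\mathcal{B}$; let $\widehat{\mathcal{B}}(E)$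 be the set of all of these. The ultrabornologification is $(E,\mathcal{B})^{\mathrm{ub}}:=\operatorname{colim}_{B\in\widehat{\mathcal{B}}(E)}(E_B,\|\cdot\|_B)$, the colimit in $\mathbf{Tc}$ (i.e. $E$ with the finest locally convex topology making all inclusions $E_B\to E$, $B\in\widehat{\mathcal{B}}(E)$, continuous). A norming disk $B\in\mathcal{B}$ is a pre-Banach disk in $(E,\mathcal{B})$ if there is a Banach disk $\widehat{B}\subseteq B$ in $(E,\mathcal{B})$ such that $B$ is contained in the closure of $\widehat{B}$ in $(E,\mathcal{B})^{\mathrm{ub}}$. Writing $(E,\mathcal{B})=\operatorname{colim}_{n\in\mathbb{N}}(E_{B_n},\|\cdot\|_{B_n})^{\mathrm b}$ (colimit in $\mathbf{Born}$) includes that for all $n$ one has $E_{B_n}\subseteq E_{B_{n+1}}$ with bounded inclusion; it then means that $E=\bigcup_n E_{B_n}$ and that a subset of $E$ belongs to $\mathcal{B}$ iff it is contained and bounded in some $(E_{B_n},\|\cdot\|_{B_n})$. *)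

(* Defs.v *)
From HB Require Import structures.
From mathcomp Require Import all_boot all_order all_algebra.
From mathcomp Require Import complex.
From mathcomp Require Import all_classical all_reals all_analysis.

Set Implicit Arguments.
Unset Strict Implicit.
Unset Printing Implicit Defensive.

Import Order.TTheory GRing.Theory Num.Theory.
Import numFieldNormedType.Exports.

Local Open Scope classical_set_scope.
Local Open Scope ring_scope.

Section Disks.
Context (K : numFieldType) (E : lmodType K).
Implicit Types A B U V : set E.

Definition absolutely_convex A :=
  forall (a c : K) (x y : E), `|a| + `|c| <= 1 -> A x -> A y ->
    A (a *: x + c *: y).

Definition absconvex_hull A : set E := smallest absolutely_convex A.

(* The bound [r] is required to be positive because in the partial order of
   a complex field [r <= `|c|] is never satisfied when [r] is not real. *)
Definition absorbs U A := exists2 r : K, 0 < r &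
  forall c : K, r <= `|c| -> A `<=` [set c *: u | u in U].

Definition linear_subspace A :=
  A 0 /\ forall (a : K) (x y : E), A x -> A y -> A (a *: x + y).

Definition lspan A : set E := smallest linear_subspace A.

Lemma absorbsS U V A : U `<=` V -> absorbs U A -> absorbs V A.
Proof.
move=> UV [r r0 h]; exists r => // c rc x /(h c rc)[u Uu <-].
by exists u => //; exact: UV.
Qed.

Lemma absorbsI U V A : absorbs U A -> absorbs V A -> absorbs (U `&` V) A.
Proof.
move=> [r r0 hr] [s s0 hs]; exists (r + s); first exact: addr_gt0.
move=> c rsc x Ax.
have rc : r <= `|c| by rewrite (le_trans _ rsc)// lerDl ltW.
have sc : s <= `|c| by rewrite (le_trans _ rsc)// lerDr ltW.
have c0 : c != 0 by rewrite -normr_gt0 (lt_le_trans r0).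
have [u Uu ux] := hr _ rc _ Ax; have [v Vv vx] := hs _ sc _ Ax.
exists u => //; split=> //.
by have -> : u = v by apply: (scalerI c0); rewrite ux vx.
Qed.

Lemma absorbsZ U A (d : K) : d != 0 -> absorbs U A ->
  absorbs [set x | U (d *: x)] A.
Proof.
move=> d0 [r r0 h]; exists (r * `|d|); first by rewrite mulr_gt0// normr_gt0.
move=> c rc x Ax.
have [|u Uu ux] := h (c / d) _ x Ax.
  by rewrite normrM normfV ler_pdivlMr// normr_gt0.
by exists (d^-1 *: u); rewrite /= ?scalerA ?divff ?scale1r.
Qed.

Lemma absolutely_convexI U V :
  absolutely_convex U -> absolutely_convex V -> absolutely_convex (U `&` V).
Proof.
by move=> cU cV a c x y ac [Ux Vx] [Uy Vy]; split; [exact: cU|exact: cV].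
Qed.

Lemma absolutely_convexZ U (d : K) :
  absolutely_convex U -> absolutely_convex [set x | U (d *: x)].
Proof.
move=> cU a c x y ac /= Ux Uy.
have -> : d *: (a *: x + c *: y) = a *: (d *: x) + c *: (d *: y).
  by rewrite scalerDr !scalerA (mulrC d) (mulrC d c).
exact: cU.
Qed.

Lemma absolutely_convex_balanced U (a : K) x :
  absolutely_convex U -> `|a| <= 1 -> U x -> U (a *: x).
Proof.
move=> cU a1 Ux; rewrite -[_ *: _]addr0 -(scale0r x).
by apply: cU => //; rewrite normr0 addr0.
Qed.

Lemma absolutely_convexD U x y : absolutely_convex U ->
  U (2 *: x) -> U (2 *: y) -> U (x + y).
Proof.
move=> cU Ux Uy.
have -> : x + y = 2^-1 *: (2 *: x) + 2^-1 *: (2 *: y).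
  by rewrite !scalerA mulVf ?scale1r// pnatr_eq0.
by apply: cU => //; rewrite ger0_norm ?invr_ge0// -[2^-1]div1r -splitr.
Qed.

End Disks.

Section LocallyConvexTopologies.
Context (K : numFieldType) (E : lmodType K).

Record convex_bornology := ConvexBornology {
  bounded_sets :> set E -> Prop ;
  bornology_cover : forall x, exists2 A, bounded_sets A & A x ;
  bornologyS : forall A B, A `<=` B -> bounded_sets B -> bounded_sets A ;
  bornologyU : forall A B,
    bounded_sets A -> bounded_sets B -> bounded_sets (A `|` B) ;
  bornologyD : forall A B, bounded_sets A -> bounded_sets B ->
    bounded_sets [set x + y | x in A & y in B] ;
  bornologyZ : forall (c : K) A,
    bounded_sets A -> bounded_sets [set c *: x | x in A] ;
  bornology_hull : forall A,
    bounded_sets A -> bounded_sets (absconvex_hull A) }.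

(* A (possibly non-Hausdorff) locally convex topology on the given vector space
   [E], represented by its filter of neighbourhoods of [0]; the topological
   vector space [(E, t)] is the type [lcs t] below. *)
Record lc_topology := LcTopology {
  nbhs0 : set_system E ;
  nbhs0_filter : Filter nbhs0 ;
  nbhs0_disk : forall U, nbhs0 U -> exists V, [/\ nbhs0 V, V `<=` U,
    absolutely_convex V & forall x, absorbs V [set x]] ;
  nbhs0_scale : forall (c : K) U, c != 0 -> nbhs0 U ->
    nbhs0 [set x | U (c *: x)] }.

Definition lcs (t : lc_topology) : Type := E.

Lemma bornology_ext (b c : convex_bornology) : (forall A, b A <-> c A) -> b = c.
Proof.
case: b c => [b b1 b2 b3 b4 b5 b6] [c c1 c2 c3 c4 c5 c6] /= bc.
have e : b = c by apply/funext => A; apply/propext.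
case: _ / e c1 c2 c3 c4 c5 c6 => *.
by congr ConvexBornology; exact: Prop_irrelevance.
Qed.

End LocallyConvexTopologies.

HB.instance Definition _ (K : numFieldType) (E : lmodType K)
  (t : lc_topology E) := GRing.Lmodule.on (lcs t).

HB.instance Definition _ (K : numFieldType) (E : lmodType K)
    (t : lc_topology E) :=
  hasNbhs.Build (lcs t) (fun x => [set A | nbhs0 t [set u | A (x + u)]]).

Section LcsInstance.
Context (K : numFieldType) (E : lmodType K) (t : lc_topology E).

#[local] Existing Instance nbhs0_filter.

Lemma nbhs_lcsE (x : lcs t) (A : set (lcs t)) :
  nbhs x A = nbhs0 t [set u : E | A (x + u)].
Proof. by []. Qed.

Let nbhs00 (U : set E) : nbhs0 t U -> U 0.
Proof.
move=> /nbhs0_disk[V [_ VU cV aV]]; apply: VU.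
have [r r0 /(_ r)] := aV 0.
rewrite gtr0_norm// => /(_ (lexx _) 0 erefl)[v Vv _].
rewrite -(scale0r v); apply: absolutely_convex_balanced => //.
by rewrite normr0.
Qed.

Let nbhs0_half (U : set E) : nbhs0 t U -> exists V, [/\ nbhs0 t V,
  absolutely_convex V, forall x, absorbs V [set x] &
  forall x y, V x -> V y -> U (x + y)].
Proof.
move=> /nbhs0_disk[V [nV VU cV aV]].
have n2 : 2 != 0 :> K by rewrite pnatr_eq0.
exists [set x | V (2 *: x)]; split.
- exact: nbhs0_scale.
- exact: absolutely_convexZ.
- by move=> x; exact: absorbsZ.
- by move=> x y /= Vx Vy; apply: VU; exact: absolutely_convexD.
Qed.

Let lcs_filter (x : lcs t) : ProperFilter (nbhs x).
Proof.
split; first by move=> /nbhs00.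
split.
- exact: (@filterT _ (nbhs0 t)).
- by move=> P Q; exact: (@filterI _ (nbhs0 t)).
- by move=> P Q PQ; apply: (@filterS _ (nbhs0 t)) => u /=; exact: PQ.
Qed.

Let lcs_singleton (x : lcs t) (A : set (lcs t)) : nbhs x A -> A x.
Proof. by move=> /nbhs00 /=; rewrite addr0. Qed.

Let lcs_nbhs (x : lcs t) (A : set (lcs t)) : nbhs x A -> nbhs x (nbhs^~ A).
Proof.
move=> /nbhs0_half[V [nV _ _ VA]].
apply: (@filterS _ (nbhs0 t) _ V) => // u Vu /=.
apply: (@filterS _ (nbhs0 t) _ V) => // v Vv /=.
by rewrite -addrA; exact: VA.
Qed.

HB.instance Definition _ :=
  Nbhs_isNbhsTopological.Build (lcs t) lcs_filter lcs_singleton lcs_nbhs.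

Let lcs_add : continuous (fun x : lcs t * lcs t => x.1 + x.2).
Proof.
move=> [x y] U /= /nbhs0_half[V [nV _ _ VU]].
have nx z : nbhs (z : lcs t) [set w : lcs t | V (w - z)].
  rewrite nbhs_lcsE; apply: (@filterS _ (nbhs0 t) _ V) => // u Vu /=.
  by rewrite addrAC subrr add0r.
exists ([set w : lcs t | V (w - x)], [set w : lcs t | V (w - y)]) => /=.
  by split; exact: nx.
move=> [a b] /= [Va Vb]; have := VU _ _ Va Vb => /=.
by rewrite addrACA [x + _]addrC subrK [y + _]addrC subrK.
Qed.

Let lcs_scale : continuous (fun z : K^o * lcs t => z.1 *: z.2).
Proof.
move=> [c x] U /= /nbhs0_half[V [nV cV aV VU]].
have [r r0 hr] := aV x.
have r1 : 0 < r + 1 by rewrite addr_gt0.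
have c1 : 0 < `|c| + 1 by rewrite ltr_wpDl.
exists (ball (c : K^o) (r + 1)^-1,
  [set w : lcs t | V ((`|c| + 1) *: (w - x : E))]) => /=.
  split; first by apply: nbhsx_ballx; rewrite invr_gt0.
  rewrite nbhs_lcsE /=.
  have := nbhs0_scale (lt0r_neq0 c1) nV.
  apply: (@filterS _ (nbhs0 t)) => u /=.
  by rewrite addrAC subrr add0r.
move=> [d y] /= []; rewrite /ball /= => cd Vy.
have d1 : `|d - c| < (r + 1)^-1 by rewrite distrC.
have -> : d *: y = c *: x + ((d - c) *: (x : E) + d *: (y - x : E)).
  rewrite scalerBr scalerBl [_ - c *: _]addrC -addrA [d *: x + _]addrC subrK.
  by rewrite addrA subrr add0r.
apply: VU.
- have [dc0|dc0] := eqVneq (d - c) 0.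
    rewrite dc0 scale0r; exact: nbhs00.
  have [|v Vv vx] := hr (d - c)^-1 _ x erefl.
    rewrite normfV -[r]invrK lef_pV2 ?posrE ?invr_gt0 ?normr_gt0//.
    by rewrite (le_trans (ltW d1))// lef_pV2 ?posrE// lerDl.
  by rewrite -vx scalerA divff// scale1r.
- have -> : d *: (y - x : E) = (d / (`|c| + 1)) *: ((`|c| + 1) *: (y - x : E)).
    by rewrite scalerA divfK// gt_eqF.
  apply: absolutely_convex_balanced => //.
  rewrite normrM normfV (gtr0_norm c1) ler_pdivrMr// mul1r.
  rewrite -[d](subrK c) (le_trans (ler_normD _ _))// addrC lerD2l.
  by rewrite (le_trans (ltW d1))// invf_le1// lerDr ltW.
Qed.

Let lcs_locally_convex : exists2 B : set_system (lcs t),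
  (forall b, b \in B -> convex_set b) & basis B.
Proof.
exists [set B | open B /\ convex_set B]; first by move=> b /set_mem[].
split; first by move=> b [].
move=> x A /= /nbhs0_disk[V [nV VA cV _]].
pose W : set (lcs t) := [set y : lcs t | V (y - x : E)].
have nW : nbhs x W.
  rewrite nbhs_lcsE; apply: (@filterS _ (nbhs0 t) _ V) => // u Vu.
  by rewrite /W /= addrAC subrr add0r.
have WA : W `<=` A by move=> y /VA /=; rewrite addrC subrK.
exists (W^°); last by move=> y /interior_subset; exact: WA.
split; last exact: nW.
split; first exact: open_interior.
move=> y z l /set_mem Wy /set_mem Wz; apply/mem_set.
move: Wy Wz; rewrite /interior /= !nbhs_lcsE => Wy Wz.
apply: (@filterS _ (nbhs0 t) _ _ _ _ (@filterI _ (nbhs0 t) _ _ _ Wy Wz)).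
move=> u [] /=; rewrite /W /= => Vy Vz.
have := cV l%:num (1 - l%:num) _ _ _ Vy Vz.
have l0 : 0 <= l%:num by [].
have l1 : 0 <= 1 - l%:num by rewrite subr_ge0.
rewrite !ger0_norm// [l%:num + _]addrC subrK => /(_ (lexx _)).
rewrite -[y + u - x]addrA -[z + u - x]addrA -[conv l y z + u - x]addrA.
have avg (a : K) (p q w : E) :
    a *: (p + w) + (1 - a) *: (q + w) = a *: p + (1 - a) *: q + w.
  by rewrite !scalerDr addrACA -scalerDl [a + _]addrC subrK scale1r.
by rewrite (avg l%:num (y : E) (z : E) (u - x : E)).
Qed.

HB.instance Definition _ := PreTopologicalLmod_isTvs.Build K (lcs t)
  lcs_add lcs_scale lcs_locally_convex.
(* The factory above only provides the uniform structure. *)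
HB.instance Definition _ :=
  PreTopologicalNmodule_isTopologicalNmodule.Build (lcs t) lcs_add.
HB.instance Definition _ :=
  TopologicalNmodule_isTopologicalLmodule.Build K (lcs t) lcs_scale.
HB.instance Definition _ :=
  Uniform_isTvs.Build K (lcs t) lcs_locally_convex.

End LcsInstance.

Section Functors.
Context (K : numFieldType) (E : lmodType K).

(* The von Neumann bornology [(E, t)^b]. *)
Definition tvs_bounded (t : lc_topology E) (A : set E) :=
  forall U : set (lcs t), nbhs 0 U -> absorbs (U : set E) A.

Section VonNeumann.
Variable t : lc_topology E.
Local Notation bdd := (tvs_bounded t).

Lemma nbhs0E (U : set E) : nbhs (0 : lcs t) U <-> nbhs0 t U.
Proof.
rewrite nbhs_lcsE; have -> // : [set u : E | U (0 + u)] = U.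
by apply/funext => u /=; rewrite add0r.
Qed.

Let bddP (A : set E) : (forall V, nbhs0 t V -> absolutely_convex V ->
  (forall x, absorbs V [set x]) -> absorbs V A) -> bdd A.
Proof.
move=> h U /nbhs0E /nbhs0_disk[V [nV VU cV aV]].
by apply: absorbsS VU _; exact: h.
Qed.

Let bdd_cover x : exists2 A, bdd A & A x.
Proof. by exists [set x] => //; apply: bddP. Qed.

Let bddS A B : A `<=` B -> bdd B -> bdd A.
Proof.
move=> AB bB U /bB[r r0 h]; exists r => // c rc.
exact: subset_trans AB (h _ rc).
Qed.

Let bddU A B : bdd A -> bdd B -> bdd (A `|` B).
Proof.
move=> bA bB U nU; have [r r0 hr] := bA U nU; have [s s0 hs] := bB U nU.
exists (r + s); first exact: addr_gt0.
by move=> c rsc x [Ax|Bx]; [apply: hr Ax|apply: hs Bx];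
  rewrite (le_trans _ rsc)// ?lerDl ?lerDr ltW.
Qed.

Let bddD A B : bdd A -> bdd B -> bdd [set x + y | x in A & y in B].
Proof.
move=> bA bB; apply: bddP => V nV cV _.
have n2 : 2 != 0 :> K by rewrite pnatr_eq0.
have nV2 := proj2 (nbhs0E _) (nbhs0_scale n2 nV).
have [r r0 hr] := bA _ nV2; have [s s0 hs] := bB _ nV2.
exists (r + s); first exact: addr_gt0.
move=> c rsc _ [x Ax [y By <-]].
have [|u /= Vu <-] := hr c _ x Ax.
  by rewrite (le_trans _ rsc)// lerDl ltW.
have [|v /= Vv <-] := hs c _ y By.
  by rewrite (le_trans _ rsc)// lerDr ltW.
by exists (u + v); [exact: absolutely_convexD|rewrite scalerDr].
Qed.

Let bddZ (d : K) A : bdd A -> bdd [set d *: x | x in A].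
Proof.
move=> bA; apply: bddP => V nV cV _.
have [r r0 h] := bA V (proj2 (nbhs0E V) nV).
have d1 : 0 < `|d| + 1 by rewrite ltr_wpDl.
exists (r * (`|d| + 1)); first exact: mulr_gt0.
move=> c rc _ [x Ax <-].
have [|u Vu <-] := h (c / (`|d| + 1)) _ x Ax.
  by rewrite normrM normfV (gtr0_norm d1) ler_pdivlMr.
exists ((d / (`|d| + 1)) *: u); last first.
  by rewrite !scalerA mulrA (mulrC c) -!mulrA (mulrA d).
apply: absolutely_convex_balanced => //.
by rewrite normrM normfV (gtr0_norm d1) ler_pdivrMr// mul1r lerDl.
Qed.

Let bdd_hull A : bdd A -> bdd (absconvex_hull A).
Proof.
move=> bA; apply: bddP => V nV cV _.
have [r r0 h] := bA V (proj2 (nbhs0E V) nV).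
exists r => // c rc x; apply; split; last exact: h.
move=> a b _ _ ab [u Vu <-] [v Vv <-].
exists (a *: u + b *: v); first exact: cV.
by rewrite scalerDr !scalerA (mulrC c) (mulrC c b).
Qed.

Definition bornology_of_topology : convex_bornology E :=
  ConvexBornology bdd_cover bddS bddU bddD bddZ bdd_hull.

End VonNeumann.

Section Bornivorous.
Variable b : convex_bornology E.

Definition bornivorous (U : set E) := forall A, b A -> absorbs U A.

Let bt : set_system E := [set U | exists V,
  [/\ V `<=` U, absolutely_convex V & bornivorous V]].

Let bt_filter : Filter bt.
Proof.
split.
- exists setT; split=> // A _; exists 1 => // c c1 x _.
  exists (c^-1 *: x) => //; rewrite scalerA divff ?scale1r//.
  by rewrite -normr_gt0 (lt_le_trans ltr01).
- move=> P Q [U [UP cU bU]] [V [VQ cV bV]]; exists (U `&` V); split.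
  + exact: setISS.
  + exact: absolutely_convexI.
  + by move=> A bA; apply: absorbsI; [exact: bU|exact: bV].
- move=> P Q PQ [V [VP cV bV]]; exists V; split=> //.
  exact: subset_trans VP PQ.
Qed.

Let bt_disk (U : set E) : bt U -> exists V,
  [/\ bt V, V `<=` U, absolutely_convex V & forall x, absorbs V [set x]].
Proof.
move=> [V [VU cV bV]]; exists V; split=> //; first by (exists V; split).
move=> x; apply: bV; have [A bA Ax] := bornology_cover b x.
by apply: bornologyS bA => _ ->.
Qed.

Let bt_scale (c : K) (U : set E) : c != 0 -> bt U -> bt [set x | U (c *: x)].
Proof.
move=> c0 [V [VU cV bV]]; exists [set x | V (c *: x)]; split.
- by move=> x /VU.
- exact: absolutely_convexZ.
- by move=> A /bV; exact: absorbsZ.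
Qed.

(* The topology of [(E, b)^t]. *)
Definition topology_of_bornology : lc_topology E :=
  LcTopology bt_filter bt_disk bt_scale.

End Bornivorous.

End Functors.

Section LBSpaces.
Context (K : numFieldType).

Definition tvs_colimit (F : nat -> tvsType K)
    (i : forall n, {linear F n -> F n.+1})
    (T : tvsType K) (j : forall n, {linear F n -> T}) :=
  [/\ forall n, continuous (j n), forall n, j n.+1 \o i n = j n &
    forall (S : tvsType K) (g : forall n, {linear F n -> S}),
      (forall n, continuous (g n)) -> (forall n, g n.+1 \o i n = g n) ->
      exists! h : T -> S,
        [/\ linear h, continuous h & forall n, h \o j n = g n]].

Definition LB_space (T : tvsType K) :=
  exists (F : nat -> completeNormedModType K)
         (i : forall n, {linear F n -> F n.+1})
         (j : forall n, {linear F n -> T}),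
    (forall n, injective (i n) /\ continuous (i n)) /\
    @tvs_colimit (fun n => F n) i T j.

End LBSpaces.

Variant base_field := RealField | ComplexField.

Definition base_scalars (R : realType) (k : base_field) : numFieldType :=
  match k with RealField => R | ComplexField => R[i]%C end.

Definition real_scalar (R : realType) (k : base_field) :
    R -> base_scalars R k :=
  match k with RealField => fun r => r | ComplexField => fun r => r%:C%C end.

Section BanachDisks.
Context (R : realType) (k : base_field) (E : lmodType (base_scalars R k)).
Implicit Types (A B : set E) (b : convex_bornology E).

Definition minkowski B (e : E) : R :=
  inf [set l : R | 0 < l /\ [set real_scalar k l *: x | x in B] e].

(* Boundedness in the (semi-)normed space [E_B = lspan B], whose (semi-)norm is
   [minkowski B]. *)
Definition disk_bounded B A :=
  A `<=` lspan B /\ exists M : R, forall x, A x -> minkowski B x <= M.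

Definition norming_disk B := [/\ B !=set0, absolutely_convex B &
  forall e, lspan B e -> minkowski B e = 0 -> e = 0].

Definition disk_complete B := forall u : nat -> E,
  (forall n, lspan B (u n)) ->
  (forall eps : R, 0 < eps -> exists N : nat, forall m n : nat,
    (N <= m)%N -> (N <= n)%N -> minkowski B (u m - u n) < eps) ->
  exists2 l, lspan B l & minkowski B (u n - l) @[n --> \oo] --> (0 : R).

Definition banach_disk B := norming_disk B /\ disk_complete B.

Definition banach_disk_in b B := banach_disk B /\ b B.

Definition disk_inclusion_continuous B (t : lc_topology E) :=
  forall x, lspan B x -> forall U : set (lcs t), nbhs (x : lcs t) U ->
  exists2 eps : R, 0 < eps &
    forall y, lspan B y -> minkowski B (y - x) < eps -> U y.

Section Ultrabornologification.
Variable b : convex_bornology E.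

Let admissible (t : lc_topology E) :=
  forall B, banach_disk_in b B -> disk_inclusion_continuous B t.

(* A set is a neighbourhood of [0] for the finest admissible topology as soon as
   it is one for some admissible topology. *)
Let ub : set_system E :=
  [set U | exists2 t : lc_topology E, admissible t & nbhs0 t U].

#[local] Existing Instance nbhs0_filter.

Let ub_setT : ub setT.
Proof.
pose N : set_system E := [set U | U = setT].
have NF : Filter N.
  split; first by [].
    by move=> P Q -> ->; rewrite /N /= setTI.
  by move=> P Q PQ P1; apply/seteqP; split => // x _; apply: PQ; rewrite P1.
have Nd U : N U -> exists V, [/\ N V, V `<=` U,
    absolutely_convex V & forall x, absorbs V [set x]].
  move=> ->; exists setT; split=> // x; exists 1 => // c c1 y _.
  exists (c^-1 *: y) => //; rewrite scalerA divff ?scale1r//.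
  by rewrite -normr_gt0 (lt_le_trans ltr01).
have Ns (c : base_scalars R k) U : c != 0 -> N U -> N [set x | U (c *: x)].
  by move=> _ ->.
exists (LcTopology NF Nd Ns) => // B _ x _ U /= U1.
exists 1 => // y _ _.
have : [set u : E | U (x + u)] (y - x) by rewrite U1.
by rewrite /= addrC subrK.
Qed.

Let ubI P Q : ub P -> ub Q -> ub (P `&` Q).
Proof.
move=> [s us sP] [t ut tQ].
pose N : set_system E := [set U | exists V W,
  [/\ nbhs0 s V, nbhs0 t W & V `&` W `<=` U]].
have NF : Filter N.
  split; first by exists setT, setT; split=> //; exact: filterT.
    move=> A A' [V [W [sV tW VWA]]] [V' [W' [sV' tW' VWA']]].
    exists (V `&` V'), (W `&` W'); split; [exact: filterI|exact: filterI|].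
    by move=> x [[? ?] [? ?]]; split; [exact: VWA|exact: VWA'].
  move=> A A' AA' [V [W [sV tW VWA]]]; exists V, W; split=> //.
  exact: subset_trans AA'.
have Nd U : N U -> exists V, [/\ N V, V `<=` U,
    absolutely_convex V & forall x, absorbs V [set x]].
  move=> [V [W [/nbhs0_disk[V' [sV' VV' cV' aV']]
    /nbhs0_disk[W' [tW' WW' cW' aW']] VWU]]].
  exists (V' `&` W'); split.
  - by exists V', W'; split.
  - by move=> x [? ?]; apply: VWU; split; [exact: VV'|exact: WW'].
  - exact: absolutely_convexI.
  - by move=> x; exact: absorbsI.
have Ns (c : base_scalars R k) U : c != 0 -> N U -> N [set x | U (c *: x)].
  move=> c0 [V [W [sV tW VWU]]].
  exists [set x | V (c *: x)], [set x | W (c *: x)].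
  by split; [exact: nbhs0_scale|exact: nbhs0_scale|move=> x; exact: VWU].
exists (LcTopology NF Nd Ns); last by exists P, Q; split.
move=> B bB x Bx U [V [W [sV tW VWU]]].
have cont r : admissible r -> forall Z : set E, nbhs0 r Z ->
    exists2 eps : R, 0 < eps & forall y, lspan B y ->
      minkowski B (y - x) < eps -> Z (y - x).
  move=> ur Z rZ; apply: (ur B bB x Bx [set y : lcs r | Z (y - x : E)]).
  rewrite nbhs_lcsE; apply: filterS rZ => u /=.
  by rewrite addrAC subrr add0r.
have [d d0 hd] := cont s us V sV; have [e e0 he] := cont t ut W tW.
exists (Num.min d e); first by rewrite lt_min d0.
move=> y By; rewrite lt_min => /andP[yd ye].
have /= := VWU _ (conj (hd y By yd) (he y By ye)).
by rewrite addrC subrK.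
Qed.

Let ub_filter : Filter ub.
Proof.
split; [exact: ub_setT|exact: ubI|].
by move=> P Q PQ [t ut tP]; exists t => //; exact: filterS tP.
Qed.

Let ub_disk (U : set E) : ub U -> exists V,
  [/\ ub V, V `<=` U, absolutely_convex V & forall x, absorbs V [set x]].
Proof.
move=> [t ut /nbhs0_disk[V [tV VU cV aV]]].
by exists V; split=> //; exists t.
Qed.

Let ub_scale (c : base_scalars R k) (U : set E) :
  c != 0 -> ub U -> ub [set x | U (c *: x)].
Proof. by move=> c0 [t ut tU]; exists t => //; exact: nbhs0_scale. Qed.

(* The topology of [(E, b)^ub]: the finest locally convex topology on [E] for
   which the inclusions of the spaces [E_B], with [B] a Banach disk in [b], are
   continuous. *)
Definition ultrabornologification : lc_topology E :=
  LcTopology ub_filter ub_disk ub_scale.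

Lemma ultrabornologification_continuous B :
  banach_disk_in b B -> disk_inclusion_continuous B ultrabornologification.
Proof. by move=> bB x Bx U [t ut tU]; exact: ut tU. Qed.

Lemma ultrabornologification_finest (t : lc_topology E) :
  (forall B, banach_disk_in b B -> disk_inclusion_continuous B t) ->
  nbhs0 t `<=` nbhs0 ultrabornologification.
Proof. by move=> ut U tU; exists t. Qed.

End Ultrabornologification.

Definition pre_banach_disk_in b B :=
  [/\ b B, norming_disk B & exists Bh : set E,
    [/\ banach_disk_in b Bh, Bh `<=` B &
      B `<=` closure (Bh : set (lcs (ultrabornologification b)))]].

(* [(E, b)] is the colimit in bornological spaces of the sequence of normed
   spaces [E_(B n)], each equipped with its norm bornology. *)
Definition born_colimit b (B : nat -> set E) :=
  [/\ forall n, lspan (B n) `<=` lspan (B n.+1),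
      forall n A, disk_bounded (B n) A -> disk_bounded (B n.+1) A,
      \bigcup_n lspan (B n) = setT &
      forall A, b A <-> exists n, disk_bounded (B n) A].

Definition functionals_separate (B : nat -> set E) :=
  forall e : E, e != 0 -> exists f : {scalar E}, f e != 0 /\
    forall n, exists M : R, forall x, B n x -> `|f x| <= real_scalar k M.

Definition closures_bounded b (B : nat -> set E) :=
  forall n, exists2 m, (n <= m)%N &
    disk_bounded (B m)
      (closure (B n : set (lcs (topology_of_bornology b)))).

End BanachDisks.

(* Main.v *)
Require Import Defs.
From HB Require Import structures.
From mathcomp Require Import all_boot all_order all_algebra.
From mathcomp Require Import complex.
From mathcomp Require Import all_classical all_reals all_analysis.
From mathcomp Require Import ring lra.

Set Implicit Arguments.
Unset Strict Implicit.
Unset Printing Implicit Defensive.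

Import Order.TTheory GRing.Theory Num.Theory.
Import numFieldNormedType.Exports.

Local Open Scope classical_set_scope.
Local Open Scope ring_scope.

(** Both conditions are translated into statements about one construction,
    the inductive topology of an increasing sequence of disks [D n] that
    spans the space: the finest locally convex topology in which all [D n]
    are bounded. Its neighbourhoods of [0] are the sets containing an
    absolutely convex set that absorbs every [D n].

    LB-spaces carry such topologies, with Banach disks in the Hausdorff case.
    If [t] is the colimit of Banach spaces [F n], then the images [D n] of
    suitable balls are increasing complete disks, they span the whole space
    and [t] is their inductive topology; the last two facts come from the
    universal property ([LB_space_inductive]). Conversely the spaces [lspan
    (D n)], normed by the gauges, are Banach spaces whose colimit is the
    inductive topology ([inductive_LB_space]). The link between the topology
    and its bounded sets is [inductive_bounded_sub]: a set that is bounded in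
    the inductive topology lies in a multiple of the closure of some [D n].

    From an LB-space to disks, the Banach disks are the [D n] and the
    pre-Banach disks are their closures. The topologies [t], [(E, b)^t] and
    [(E, b)^ub] compare well enough for [closure (D n)] to be a closure in
    each of them, and the theorem of Hahn and Banach ([disk_separation])
    provides the functionals.

    From disks to an LB-space, let [C n] be the Banach disk that is dense in
    [B n]. The partial sums [D n] of the disks [Bh i + C i] are Banach disks,
    because complete disks are stable under sums and bounded sets contain no
    line. The key point is that every Banach disk of [b] is absorbed by some
    [D n]: this is the factorization theorem of Grothendieck
    ([grothendieck_factorization]), a combination of the Baire category
    theorem and of the open mapping theorem. Hence the inductive topology [t]
    of [D] is coarser than [(E, b)^ub], so that [B n], being in the closure
    of [C n], is bounded in [t]. In the other direction, a bounded set of [t]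
    lies in a multiple of the closure of some [D n], thus of that of some [B
    m]; as [t] is finer than [(E, b)^t], the condition on closures makes it a
    member of [b]. The functionals that separate points are continuous, which
    makes [t] Hausdorff. *)

(** * Real scalars *)

Section RealScalars.
Context {R : realType} (k : base_field).
Local Notation K := (base_scalars R k).
Local Notation rs := (@real_scalar R k).

Fact real_scalar_is_zmod_morphism : zmod_morphism rs.
Proof. by case: k => // x y /=; rewrite rmorphB. Qed.

Fact real_scalar_is_monoid_morphism : monoid_morphism rs.
Proof. by case: k; split=> //= x y; rewrite rmorphM. Qed.

HB.instance Definition _ :=
  GRing.isZmodMorphism.Build R K rs real_scalar_is_zmod_morphism.
HB.instance Definition _ :=
  GRing.isMonoidMorphism.Build R K rs real_scalar_is_monoid_morphism.

Lemma ler_rs (x y : R) : (rs x <= rs y) = (x <= y).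
Proof. by case: k => //=; rewrite lecR. Qed.

Lemma ltr_rs (x y : R) : (rs x < rs y) = (x < y).
Proof. by case: k => //=; rewrite ltcR. Qed.

Lemma rs_gt0 (x : R) : (0 < rs x) = (0 < x).
Proof. by rewrite -ltr_rs rmorph0. Qed.

Lemma rs_ge0 (x : R) : (0 <= rs x) = (0 <= x).
Proof. by rewrite -ler_rs rmorph0. Qed.

Lemma rs_eq0 (x : R) : (rs x == 0) = (x == 0).
Proof. by rewrite fmorph_eq0. Qed.

Lemma norm_rs (x : R) : `|rs x| = rs `|x|.
Proof.
wlog x0 : x / 0 <= x => [h|].
  have [/h//|/ltW x0] := leP 0 x.
  by rewrite -normrN -rmorphN h ?oppr_ge0// normrN.
by rewrite !ger0_norm// rs_ge0.
Qed.

Lemma norm_realP (c : K) : exists2 r : R, 0 <= r & `|c| = rs r.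
Proof.
case: k c => /= c; first by exists `|c|.
exists (Normc.normc c); last by [].
by case: c => x y /=; rewrite sqrtr_ge0.
Qed.

Lemma pos_realP (c : K) : 0 < c -> exists2 r : R, 0 < r & c = rs r.
Proof.
move=> c0; have [r r0 cr] := norm_realP c.
by exists r; rewrite -?rs_gt0 -?cr gtr0_norm.
Qed.

End RealScalars.

(** * Absolutely convex sets and their gauges *)

Section Disks.
Context {R : realType} {k : base_field} {E : lmodType (base_scalars R k)}.
Local Notation rs := (@real_scalar R k).
Local Notation gauge := (@Defs.minkowski R k E).
Implicit Types (A B U : set E) (l m r : R) (x y : E).

Lemma increasing_subset (D : nat -> set E) : (forall n, D n `<=` D n.+1) ->
  forall n m : nat, (n <= m)%N -> D n `<=` D m.
Proof.
move=> DS n m; apply: (@homo_leq _ D subset) => //; first by move=> A x.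
by move=> B A C AB BC x /AB/BC.
Qed.

Definition dilate l B : set E := [set rs l *: x | x in B].

Lemma dilate1 B : dilate 1 B = B.
Proof.
apply/seteqP; split=> [_ [x Bx <-]|x Bx]; first by rewrite rmorph1 scale1r.
by exists x; rewrite // rmorph1 scale1r.
Qed.

Lemma dilateS A B l : A `<=` B -> dilate l A `<=` dilate l B.
Proof. by move=> AB _ [x /AB Bx <-]; exists x. Qed.

Lemma dilateM l m B x : dilate m B x -> dilate (l * m) B (rs l *: x).
Proof. by move=> [b Bb <-]; exists b => //; rewrite rmorphM scalerA. Qed.

Lemma dilate_dilate l m B : dilate l (dilate m B) = dilate (l * m) B.
Proof.
apply/seteqP; split=> [_ [x Bx <-]|_ [x Bx <-]]; first exact: dilateM.
by exists (rs m *: x); [exists x|rewrite rmorphM scalerA].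
Qed.

Lemma dilateV l B x : 0 < l -> dilate l B x <-> B (rs l^-1 *: x).
Proof.
move=> l0; have rl0 : rs l != 0 by rewrite rs_eq0 gt_eqF.
split=> [[b Bb <-]|Bx].
  by rewrite scalerA -rmorphM mulVf ?gt_eqF// rmorph1 scale1r.
exists (rs l^-1 *: x) => //.
by rewrite scalerA -rmorphM mulfV ?gt_eqF// rmorph1 scale1r.
Qed.

Lemma absolutely_convex0 B : absolutely_convex B -> B !=set0 -> B 0.
Proof.
move=> cB [x Bx]; rewrite -(scale0r x).
by apply: absolutely_convex_balanced => //; rewrite normr0.
Qed.

Section AbsolutelyConvex.
Variable B : set E.
Hypothesis cB : absolutely_convex B.

Lemma dilateZ (c : base_scalars R k) r l x : `|c| = rs r ->
  dilate l B x -> dilate (r * l) B (c *: x).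
Proof.
move=> cr [b Bb <-]; have [r0|r0] := eqVneq r 0.
  move: cr; rewrite r0 rmorph0 => /normr0_eq0 ->.
  by exists b => //; rewrite mul0r rmorph0 !scale0r.
exists ((c / rs r) *: b).
  apply: absolutely_convex_balanced => //.
  rewrite normrM normfV -cr normr_id divff//.
  by rewrite cr rs_eq0.
rewrite !scalerA rmorphM [rs r * _]mulrC -mulrA [rs r * _]mulrC.
by rewrite divfK ?rs_eq0// [rs l * c]mulrC.
Qed.

Lemma dilateN l x : dilate l B x -> dilate l B (- x).
Proof.
move=> Bx; rewrite -scaleN1r -[l]mul1r; apply: dilateZ => //.
by rewrite normrN1 rmorph1.
Qed.

Lemma dilate_le l m : 0 <= l -> l <= m -> dilate l B `<=` dilate m B.
Proof.
move=> l0 lm _ [b Bb <-]; have [m0|m0] := eqVneq m 0.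
  have -> : l = 0 by apply/eqP; rewrite eq_le l0 andbT -m0.
  by exists b => //; rewrite m0.
have m1 : 0 < m by rewrite lt_neqAle eq_sym m0 (le_trans l0).
exists (rs (l / m) *: b).
  apply: absolutely_convex_balanced => //.
  rewrite norm_rs ger0_norm ?divr_ge0 ?(ltW m1)//.
  by rewrite -(rmorph1 rs) ler_rs ler_pdivrMr// mul1r.
by rewrite scalerA -rmorphM mulrCA divff// mulr1.
Qed.

Lemma dilateD l m x y : 0 <= l -> 0 <= m ->
  dilate l B x -> dilate m B y -> dilate (l + m) B (x + y).
Proof.
move=> l0 m0 [a Ba <-] [b Bb <-]; have [lm0|lm0] := eqVneq (l + m) 0.
  move/eqP: lm0; rewrite paddr_eq0// => /andP[/eqP -> /eqP ->].
  by exists a => //; rewrite addr0 rmorph0 !scale0r addr0.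
have lm1 : 0 < l + m by rewrite lt_neqAle eq_sym lm0 addr_ge0.
exists (rs (l / (l + m)) *: a + rs (m / (l + m)) *: b).
  apply: cB => //; rewrite !norm_rs -rmorphD -(rmorph1 rs) ler_rs.
  by rewrite !ger0_norm ?divr_ge0// ?addr_ge0// -mulrDl divff.
by rewrite scalerDr !scalerA -!rmorphM ![(l + m) * _]mulrCA divff// !mulr1.
Qed.

(** For an absolutely convex set a single large enough multiple decides
    absorption, so that real radii suffice. *)
Lemma absorbsP A : absorbs B A <-> exists2 r, 0 < r & A `<=` dilate r B.
Proof.
split=> [[c /pos_realP[r r0 ->] h]|[r r0 h]].
  by exists r => //; apply: h; rewrite norm_rs gtr0_norm.
exists (rs r); first by rewrite rs_gt0.
move=> c; have [s s0 cs] := norm_realP c.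
rewrite cs ler_rs => rs_le x /h /(dilate_le (ltW r0) rs_le).
have s1 : 0 < s := lt_le_trans r0 rs_le.
have c0 : c != 0 by rewrite -normr_gt0 cs rs_gt0.
move=> /(@dilateZ c^-1 s^-1); rewrite normfV cs fmorphV => /(_ erefl).
rewrite mulVf ?gt_eqF// dilate1 => Bx; exists (c^-1 *: x) => //.
by rewrite scalerA divff// scale1r.
Qed.

Hypothesis B0 : B !=set0.

(** The multiples of an absolutely convex set are directed, so that their
    union is already a subspace. *)
Lemma lspanP x : lspan B x <-> exists2 l, 0 < l & dilate l B x.
Proof.
split=> [|[l l0 [b Bb <-]] S [[S0 lS] BS]]; last first.
  by rewrite -[_ *: _]addr0; apply: lS => //; exact: BS.
move=> /(_ [set y | exists2 l, 0 < l & dilate l B y]); apply; split=> [|y By].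
  2: by exists 1; rewrite ?dilate1.
split=> [|a y z [l l0 By] [m m0 Bz]].
  by exists 1; rewrite // dilate1; exact: absolutely_convex0.
have [r r0 ar] := norm_realP a.
exists (r * l + m); first by rewrite ltr_wpDl// mulr_ge0// ltW.
apply: dilateD; rewrite ?mulr_ge0// 1?ltW//; exact: dilateZ.
Qed.

Lemma dilate_lspan l : 0 < l -> dilate l B `<=` lspan B.
Proof. by move=> l0 x Bx; apply/lspanP; exists l. Qed.

Lemma sub_lspan : B `<=` lspan B.
Proof. by move=> x Bx S [_]; apply. Qed.

Let gaugeset x := [set l : R | 0 < l /\ dilate l B x].

Lemma gaugeE x : gauge B x = inf (gaugeset x).
Proof. by []. Qed.

Lemma gauge_le l x : 0 < l -> dilate l B x -> gauge B x <= l.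
Proof.
by move=> l0 Bx; apply: ge_inf; [exists 0 => m [/ltW]|split].
Qed.

Lemma gauge_ge0 x : 0 <= gauge B x.
Proof.
rewrite gaugeE; have [->|/set0P gx] := eqVneq (gaugeset x) set0.
  by rewrite inf0.
by apply: lb_le_inf => // l [/ltW].
Qed.

Lemma gauge_lt l x : lspan B x -> gauge B x < l -> dilate l B x.
Proof.
move=> /lspanP[m m0 Bx] /inf_lt[]; first by exists m.
move=> n [n0 nx] nl; apply: dilate_le nx; exact: ltW.
Qed.

Lemma gauge0 : gauge B 0 = 0.
Proof.
apply/eqP; rewrite eq_le gauge_ge0 andbT; apply/ler_addgt0Pl => e e0.
rewrite addr0; apply: gauge_le => //; exists 0; rewrite ?scaler0//.
exact: absolutely_convex0.
Qed.

Lemma gaugeD x y : lspan B x -> lspan B y ->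
  gauge B (x + y) <= gauge B x + gauge B y.
Proof.
move=> Bx By; apply/ler_addgt0Pl => e e0.
have e2 : 0 < e / 2 by rewrite divr_gt0.
have px z := ltr_wpDr (gauge_ge0 z) e2.
rewrite [e + _]addrC [e]splitr addrACA; apply: gauge_le.
  by rewrite addr_gt0// ltr_wpDl ?gauge_ge0.
by apply: dilateD; rewrite ?addr_ge0 ?gauge_ge0// 1?ltW//;
  apply: gauge_lt => //; rewrite ltrDl.
Qed.

Lemma lspan_subspace : linear_subspace (lspan B).
Proof.
split=> [S [[]]//|a x y Bx By S SB]; have [[S0 lS] BS] := SB.
by apply: lS; [exact: Bx|exact: By].
Qed.

Lemma gaugeZ (c : base_scalars R k) r x : lspan B x -> `|c| = rs r ->
  gauge B (c *: x) = r * gauge B x.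
Proof.
have [lB0 lBS] := lspan_subspace.
have lZ (d : base_scalars R k) y : lspan B y -> lspan B (d *: y).
  by move=> By; rewrite -[_ *: _]addr0; exact: lBS.
have le (d : base_scalars R k) s y : lspan B y -> 0 < s -> `|d| = rs s ->
    gauge B (d *: y) <= s * gauge B y.
  move=> By s0 ds; rewrite -ler_pdivrMl//; apply/ler_addgt0Pl => e e0.
  rewrite ler_pdivrMl//; apply: gauge_le.
    by rewrite mulr_gt0// ltr_pwDl// gauge_ge0.
  by apply: dilateZ => //; apply: gauge_lt => //; rewrite ltrDr.
move=> Bx cr; have [c0|c0] := eqVneq c 0.
  move: cr; rewrite c0 normr0 scale0r gauge0 -(rmorph0 rs).
  by move=> /(fmorph_inj rs) <-; rewrite mul0r.
have r0 : 0 < r by rewrite -(rs_gt0 k) -cr normr_gt0.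
apply/eqP; rewrite eq_le le//= mulrC -ler_pdivlMr// mulrC.
rewrite -{1}(scalerK c0 x); apply: le; rewrite ?invr_gt0//; first exact: lZ.
by rewrite normfV cr fmorphV.
Qed.

Lemma disk_boundedP A :
  disk_bounded B A <-> exists2 r, 0 < r & A `<=` dilate r B.
Proof.
split=> [[AB [M AM]]|[r r0 Ar]].
  exists (`|M| + 1) => [|x Ax]; first by rewrite ltr_wpDl.
  apply: gauge_lt; first exact: AB.
  by rewrite (le_lt_trans (AM _ Ax))// (le_lt_trans (ler_norm M))// ltrDl.
split=> [x /Ar|]; first exact: dilate_lspan.
by exists r => x /Ar; exact: gauge_le.
Qed.

End AbsolutelyConvex.

End Disks.

(** * Completeness through rapidly convergent series *)

Section FastSeries.
Context {R : realType}.

Lemma halving_expn (a : nat -> R) n : (forall n, a n.+1 <= a n / 2) ->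
  a n <= a 0%N / 2 ^+ n.
Proof.
move=> ha; elim: n => [|n IH]; first by rewrite expr0 divr1.
by rewrite (le_trans (ha n))// exprSr invfM mulrA ler_pM2r.
Qed.

Lemma small_half (c e : R) : 0 < e -> exists n, c / 2 ^+ n < e.
Proof.
move=> e0; exists (Num.bound (c / e)).
rewrite ltr_pdivrMr ?exprn_gt0// mulrC -ltr_pdivrMr//.
have [ce|ce] := ltP (c / e) 0; first by rewrite (lt_le_trans ce)// exprn_ge0.
rewrite (lt_le_trans (archi_boundP ce))// -natrX ler_nat.
by rewrite ltnW// ltn_expl.
Qed.

Lemma halving_small (a : nat -> R) (e : R) : (forall n, a n.+1 <= a n / 2) ->
  0 < e -> exists n, a n < e.
Proof.
move=> ha /(small_half (a 0%N))[n an]; exists n.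
exact: le_lt_trans (halving_expn n ha) an.
Qed.

End FastSeries.

Section FastComplete.
Context {R : realType} {k : base_field}.
Local Notation K := (base_scalars R k).
Local Notation rs := (@real_scalar R k).
Local Notation gauge := Defs.minkowski.

(** Completeness of the normed space spanned by [B], expressed by means of the
    multiples of [B] only: series dominated by a geometric one converge, with
    control of the remainders. In this form completeness passes to images and
    to sums. The remainders of such a series lie in [2 * a n] times the ball;
    the constant [4] leaves room for the passage to the limit. *)
Definition fast_complete (E : lmodType K) (B : set E) :=
  forall (a : nat -> R) (v : nat -> E), (forall n, 0 < a n) ->
    (forall n, a n.+1 <= a n / 2) -> (forall n, B (v n)) ->
  exists s, forall n,
    dilate (4 * a n) B (s - \sum_(i < n) rs (a i) *: v i).

(** The sum of the [a i] with [n <= i < m] is at most [2 * (a n - a m)], since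
    the sequence is at least halved at each step. *)
Lemma partial_sum_dilate (E : lmodType K) (B : set E) (a : nat -> R)
    (v : nat -> E) n m : absolutely_convex B -> (forall n, 0 < a n) ->
    (forall n, a n.+1 <= a n / 2) -> (forall n, B (v n)) -> (n <= m)%N ->
  dilate (2 * a n) B
    (\sum_(i < m) rs (a i) *: v i - \sum_(i < n) rs (a i) *: v i).
Proof.
move=> cB a0 ha Bv /subnKC <-; set j := (m - n)%N.
suff [d d0 Bd] : exists2 d, 0 <= d <= 2 * (a n - a (n + j)%N) & dilate d B
    (\sum_(i < n + j) rs (a i) *: v i - \sum_(i < n) rs (a i) *: v i).
  move/andP: d0 => [d0 dn]; apply: dilate_le Bd => //.
  by rewrite (le_trans dn)// ler_pM2l// gerBl ltW.
elim: j => [|j [d /andP[d0 dj] Bd]].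
  exists 0; first by rewrite addn0 subrr mulr0 lexx.
  by rewrite addn0 subrr; exists (v 0%N); rewrite // rmorph0 scale0r.
exists (d + a (n + j)%N).
  rewrite addr_ge0 ?(ltW (a0 _))//= addnS (le_trans (lerD dj (lexx _)))//.
  have := ha (n + j)%N; rewrite ler_pdivlMr// => ha'.
  by rewrite !mulrBr -addrA lerD2l mulrC (mulrC 2) ; lra.
rewrite addnS big_ord_recr/= addrAC; apply: dilateD => //; first exact: ltW.
by exists (v (n + j)%N).
Qed.

Lemma disk_complete_fast (E : lmodType K) (B : set E) : absolutely_convex B ->
  B !=set0 -> disk_complete B -> fast_complete B.
Proof.
move=> cB B0 compB a v a0 ha Bv.
pose S n := \sum_(i < n) rs (a i) *: v i.
have Sd n m : (n <= m)%N -> dilate (2 * a n) B (S m - S n).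
  exact: partial_sum_dilate.
have [lB0 lBS] := lspan_subspace B.
have lS n : lspan B (S n).
  rewrite /S; elim: n => [|n IH]; first by rewrite big_ord0.
  by rewrite big_ord_recr/= addrC; apply: lBS => //; exact: sub_lspan.
have [||l Bl Sl] := compB S; first exact: lS.
  move=> e e0; have e4 : 0 < e / 5 by rewrite divr_gt0.
  have [N aN] := halving_small ha e4.
  exists N => m n Nm Nn; apply: (@le_lt_trans _ _ (4 * a N)); last first.
    by move: aN; rewrite ltr_pdivlMr// => aN; have := a0 N; lra.
  have -> : S m - S n = (S m - S N) + - (S n - S N).
    by rewrite opprB addrA subrK.
  have -> : 4 * a N = 2 * a N + 2 * a N by lra.
  have p0 : 0 < 2 * a N by rewrite mulr_gt0.
  apply: gauge_le; first exact: addr_gt0.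
  by apply: dilateD; rewrite ?(ltW p0)//;
    [exact: Sd|apply: dilateN => //; exact: Sd].
exists l => n.
have /cvgrPdist_lt/(_ _ (a0 n))[N _ SN] := Sl.
pose m := maxn n N.
have -> : l - S n = - (S m - l) + (S m - S n) by rewrite opprB addrA subrK.
apply: (@dilate_le _ _ _ _ cB (a n + 2 * a n)).
- by rewrite addr_ge0// ?mulr_ge0// ltW.
- by have := a0 n; lra.
apply: dilateD => //; [exact: ltW|by rewrite mulr_ge0// ltW| |]; last first.
  by apply: Sd; rewrite leq_maxl.
apply: dilateN => //; apply: gauge_lt => //.
  by rewrite -[l]scale1r -scaleNr addrC; exact: lBS.
have := SN m (leq_maxr _ _); rewrite sub0r normrN ger0_norm//.
exact: gauge_ge0.
Qed.

(** A Cauchy sequence has a subsequence whose increments are dominated by the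
    powers of [1 / 2]; the subsequence is a series to which the hypothesis
    applies, and the whole sequence follows it. *)
Lemma fast_complete_disk (E : lmodType K) (B : set E) : absolutely_convex B ->
  B !=set0 -> fast_complete B -> disk_complete B.
Proof.
move=> cB B0 compB u Bu cu.
have [lB0 lBS] := lspan_subspace B.
have lBB x y : lspan B x -> lspan B y -> lspan B (x - y).
  by move=> Bx By; rewrite addrC -scaleN1r; exact: lBS.
pose a n : R := 2^-1 ^+ n.
have a0 n : 0 < a n by rewrite exprn_gt0.
have ha n : a n.+1 <= a n / 2 by rewrite /a exprSr.
have /choice[N NP] : forall j, exists N : nat, forall m n,
    (N <= m)%N -> (N <= n)%N -> gauge B (u m - u n) < a j.
  by move=> j; have [N] := cu _ (a0 j); exists N.
pose p j := (\sum_(i < j.+1) N i)%N.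
have Np j m : (p j <= m)%N -> (N j <= m)%N.
  by apply: leq_trans; rewrite /p big_ord_recr leq_addl.
have pS j : (p j <= p j.+1)%N by rewrite /p [leqRHS]big_ord_recr leq_addr.
have /choice[v vP] j : exists v, B v /\ rs (a j) *: v = u (p j.+1) - u (p j).
  have [||v Bv <-] := @gauge_lt _ _ _ _ cB B0 (a j) (u (p j.+1) - u (p j)).
  - exact: lBB.
  - by apply: NP; apply: Np.
  - by exists v.
have [|s sP] := compB a v a0 ha; first by move=> n; have [] := vP n.
have Sp n : \sum_(i < n) rs (a i) *: v i = u (p n) - u (p 0%N).
  elim: n => [|n IH]; first by rewrite big_ord0 subrr.
  by rewrite big_ord_recr/= IH (vP n).2 addrC addrA subrK.
have ls : lspan B s.
  have a4 : 0 < 4 * a 0%N by rewrite mulr_gt0.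
  by have := dilate_lspan cB B0 a4 (sP 0%N); rewrite big_ord0 subr0.
exists (s + u (p 0%N)); first by rewrite addrC -[u _]scale1r; exact: lBS.
apply/cvgrPdist_lt => e e0.
have e5 : 0 < e / 5 by rewrite divr_gt0.
have [n an] := halving_small ha e5.
exists (p n) => // m /= pm.
rewrite sub0r normrN ger0_norm; last exact: gauge_ge0.
have -> : u m - (s + u (p 0%N)) = (u m - u (p n)) +
    - (s - \sum_(i < n) rs (a i) *: v i).
  by rewrite Sp opprB !addrA subrK -addrA -opprD [s + _]addrC.
apply: (@le_lt_trans _ _ (a n + 4 * a n)); last first.
  by move: an; rewrite ltr_pdivlMr//; lra.
apply: gauge_le; first by rewrite addr_gt0// mulr_gt0.
apply: dilateD; rewrite ?mulr_ge0 ?(ltW (a0 n))//.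
  by apply: gauge_lt => //; [exact: lBB|apply: NP => //; exact: Np].
exact: dilateN.
Qed.

(** The terms of a series in the sum are split into terms in [A] and in [B],
    whose series converge separately. *)
Lemma fast_completeD (E : lmodType K) (A B : set E) :
  fast_complete A -> fast_complete B ->
  fast_complete [set x + y | x in A & y in B].
Proof.
move=> fA fB a v a0 ha ABv.
have /choice[x xP] n : exists x, A x /\ B (v n - x).
  have [x Ax [y By <-]] := ABv n.
  by exists x; rewrite addrAC subrr add0r.
have [s sA] := fA a x a0 ha (fun n => (xP n).1).
have [t tB] := fB a (fun n => v n - x n) a0 ha (fun n => (xP n).2).
exists (s + t) => n; have [p Ap ps] := sA n; have [q Bq qt] := tB n.
exists (p + q); first by exists p => //; exists q.
rewrite scalerDr ps qt addrACA -opprD -big_split/=; congr (_ - _).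
by apply: eq_bigr => i _; rewrite -scalerDr addrC subrK.
Qed.

Lemma fast_complete_image (F E : lmodType K) (f : {linear F -> E}) (B : set F) :
  fast_complete B -> fast_complete (f @` B).
Proof.
move=> fB a v a0 ha Bv.
have /choice[w wP] n : exists w, B w /\ f w = v n.
  by have [w Bw <-] := Bv n; exists w.
have [s sB] := fB a w a0 ha (fun n => (wP n).1).
exists (f s) => n; have [p Bp ps] := sB n; exists (f p); first by exists p.
rewrite -linearZ/= ps linearB linear_sum/=; congr (_ - _).
by apply: eq_bigr => i _; rewrite linearZ/= (wP i).2.
Qed.

Lemma closed_ball_absolutely_convex (F : normedModType K) (c : R) :
  0 <= c -> absolutely_convex [set x : F | `|x| <= rs c].
Proof.
move=> c0 a b x y ab /= xc yc.
rewrite (le_trans (ler_normD _ _))// !normrZ -[leRHS]mul1r.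
rewrite (le_trans _ (ler_wpM2r _ ab)) ?rs_ge0// mulrDl.
by rewrite lerD// ler_wpM2l.
Qed.

Lemma closed_ball_fast_complete (F : completeNormedModType K) (c : R) :
  0 < c -> fast_complete [set x : F | `|x| <= rs c].
Proof.
move=> c0 a v a0 ha Bv.
pose B := [set x : F | `|x| <= rs c].
have cB : absolutely_convex B by exact/closed_ball_absolutely_convex/ltW.
pose S n := \sum_(i < n) rs (a i) *: v i.
have dP l x : 0 < l -> dilate l B x <-> `|x| <= rs (l * c).
  move=> l0; rewrite dilateV// /B/= normrZ norm_rs gtr0_norm ?invr_gt0//.
  by rewrite fmorphV ler_pdivrMl ?rs_gt0// rmorphM.
have Sd n m : (n <= m)%N -> `|S m - S n| <= rs (2 * a n * c).
  by move=> nm; apply/dP; rewrite ?mulr_gt0//; exact: partial_sum_dilate.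
have /cauchy_cvgP/cvg_ex[l Sl] : cauchy (S @ \oo).
  apply: cauchy_exP => _/pos_realP[e e0 ->].
  have e2 : 0 < e / 2 / c by rewrite !divr_gt0.
  have [N aN] := halving_small ha e2.
  exists (S N); exists N => // m Nm; rewrite -ball_normE/=.
  rewrite distrC (le_lt_trans (Sd _ _ Nm))// ltr_rs.
  by move: aN; rewrite !ltr_pdivlMr//; lra.
exists l => n; rewrite dP ?mulr_gt0//.
move: Sl => /cvgrPdist_lt/(_ (rs (a n * c))).
rewrite rs_gt0 mulr_gt0// => /(_ isT)[N _ SN].
pose m := maxn n N.
rewrite -[l](subrK (S m)) -addrA (le_trans (ler_normD _ _))//.
apply: (@le_trans _ _ (rs (a n * c) + rs (2 * a n * c))).
  by rewrite lerD ?Sd ?leq_maxl// ltW// SN//= leq_maxr.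
rewrite -rmorphD ler_rs; have : 0 < a n * c by rewrite mulr_gt0.
by rewrite -!mulrA; lra.
Qed.
End FastComplete.

(** * Locally convex topologies and their bounded sets *)

Section Topologies.
Context {R : realType} {k : base_field} {E : lmodType (base_scalars R k)}.
Local Notation rs := (@real_scalar R k).
Local Notation gauge := (@Defs.minkowski R k E).
Implicit Types (t : lc_topology E) (b : convex_bornology E).
Implicit Types (A B U V : set E).

#[local] Existing Instance nbhs0_filter.

Lemma nbhs0_absolutely_convex t U : nbhs0 t U ->
  exists V, [/\ nbhs0 t V, V `<=` U & absolutely_convex V].
Proof. by move=> /nbhs0_disk[V [tV VU cV _]]; exists V. Qed.

Lemma nbhs0_absorbs_point t U x : nbhs0 t U -> absorbs U [set x].
Proof. by move=> /nbhs0_disk[V [_ VU _ /(_ x)]]; exact: absorbsS. Qed.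

Lemma nbhs00 t U : nbhs0 t U -> U 0.
Proof. by move=> /(nbhs0E _ _).2 tU; exact: nbhs_singleton tU. Qed.

(** The neighbourhoods of a point are the translates of those of [0]. *)
Lemma nbhs0_closureP t A x : closure (A : set (lcs t)) x <->
  forall U, nbhs0 t U -> exists2 a, A a & U (a - x).
Proof.
split=> [Ax U tU|h U].
  have [|a [Aa Ua]] := Ax [set a : lcs t | U (a - x : E)].
    rewrite nbhs_lcsE; apply: filterS tU => u /=.
    by rewrite addrAC subrr add0r.
  by exists a.
rewrite nbhs_lcsE => /h[a Aa]; rewrite /= addrC subrK => Ua.
by exists a.
Qed.

Lemma lcs_hausdorffP t : hausdorff_space (lcs t) <->
  forall x : E, x != 0 -> exists2 U, nbhs0 t U & ~ U x.
Proof.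
split=> [ht x x0|h x y xy].
  apply: contrapT => nU; move/eqP: x0; apply.
  symmetry; apply: (ht (0 : lcs t) (x : lcs t)) => U V.
  move=> /nbhs0E tU /nbhs_singleton Vx; exists x; split => //.
  by apply: contrapT => Ux; apply: nU; exists U.
apply/eqP; rewrite -subr_eq0; apply/eqP; apply: contrapT => /eqP/h[U tU].
have [V [tV VU cV]] := nbhs0_absolutely_convex tU.
have n2 : 2 != 0 :> base_scalars R k by rewrite pnatr_eq0.
have tW := nbhs0_scale n2 tV; apply.
have nb (z : E) : nbhs (z : lcs t) [set u : lcs t | V (2 *: (u - z : E))].
  rewrite nbhs_lcsE; apply: filterS tW => u /=.
  by rewrite addrAC subrr add0r.
have [z [Vx Vy]] := xy _ _ (nb x) (nb y).
apply: VU; have -> : (x - y : E) = - (z - x) + (z - y).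
  by rewrite opprB addrA subrK.
apply: absolutely_convexD => //.
rewrite scalerN -scaleN1r; apply: absolutely_convex_balanced => //.
by rewrite normrN1.
Qed.

Lemma sub_closure t A : A `<=` closure (A : set (lcs t)).
Proof. exact: (@subset_closure (lcs t) A). Qed.

Lemma closure_nbhsS s t A : nbhs0 s `<=` nbhs0 t ->
  closure (A : set (lcs t)) `<=` closure (A : set (lcs s)).
Proof.
by move=> st x /nbhs0_closureP Ax; apply/nbhs0_closureP => U /st/Ax.
Qed.

Lemma closure_absolutely_convex t A : absolutely_convex A ->
  absolutely_convex (closure (A : set (lcs t)) : set E).
Proof.
move=> cA a c x y ac /nbhs0_closureP Ax /nbhs0_closureP Ay.
apply/nbhs0_closureP => U /nbhs0_absolutely_convex[V [tV VU cV]].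
have [u Au Vu] := Ax _ tV; have [v Av Vv] := Ay _ tV.
exists (a *: u + c *: v); first exact: cA.
apply: VU; have -> : a *: u + c *: v - (a *: x + c *: y) =
    a *: (u - x) + c *: (v - y) by rewrite !scalerBr opprD addrACA.
exact: cV.
Qed.

Lemma closure_dilate t A l : 0 < l ->
  closure (dilate l A : set (lcs t)) `<=` dilate l (closure (A : set (lcs t))).
Proof.
move=> l0 x /nbhs0_closureP Ax; apply/dilateV => //.
apply/nbhs0_closureP => U tU.
have l1 : rs l^-1 != 0 by rewrite rs_eq0 invr_eq0 gt_eqF.
have [_ [a Aa <-] /= Ua] := Ax _ (nbhs0_scale l1 tU); exists a => //.
move: Ua; rewrite scalerBr scalerA -rmorphM mulVf ?gt_eqF//.
by rewrite rmorph1 scale1r.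
Qed.

Lemma tvs_boundedP t A : tvs_bounded t A <->
  forall V, nbhs0 t V -> absolutely_convex V ->
    exists2 r, 0 < r & A `<=` dilate r V.
Proof.
split=> [bA V tV cV|h U /nbhs0E/nbhs0_absolutely_convex[V [tV VU cV]]].
  by apply/absorbsP => //; apply: bA; apply/nbhs0E.
by apply: absorbsS VU _; apply/absorbsP => //; exact: h.
Qed.

Lemma tvs_bounded_closure t A :
  tvs_bounded t A -> tvs_bounded t (closure (A : set (lcs t))).
Proof.
move=> bA; apply/tvs_boundedP => V tV cV.
have n2 : 2 != 0 :> base_scalars R k by rewrite pnatr_eq0.
have [r r0 Ar] := (tvs_boundedP _ _).1 bA V tV cV.
exists (r + 1) => [|x /nbhs0_closureP/(_ V tV)[a /Ar ra Va]].
  by rewrite addr_gt0.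
rewrite -(subKr a x); apply: dilateD => //; first exact: ltW.
by apply: dilateN => //; rewrite dilate1.
Qed.

Lemma disk_inclusion_continuousP B t : absolutely_convex B -> B !=set0 ->
  disk_inclusion_continuous B t <->
  forall V, nbhs0 t V -> absolutely_convex V ->
    exists2 r, 0 < r & B `<=` dilate r V.
Proof.
move=> cB B0; have [lB0 _] := lspan_subspace B.
split=> [ctB V tV cV|h x Bx U].
  have [|e e0 eV] := ctB 0 lB0 V; first exact/nbhs0E.
  exists (2 / e) => [|x Bx]; first by rewrite divr_gt0.
  apply/dilateV; first by rewrite divr_gt0.
  rewrite invf_div; have e2 : 0 < e / 2 by rewrite divr_gt0.
  have Bex : dilate (e / 2) B (rs (e / 2) *: x) by exists x.
  apply: eV; first exact: dilate_lspan Bex.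
  rewrite subr0 (le_lt_trans (gauge_le e2 Bex))//.
  by rewrite ltr_pdivrMr// ltr_pMr// ltr1n.
rewrite nbhs_lcsE => /nbhs0_absolutely_convex[V [tV VU cV]].
have [r r0 Br] := h V tV cV.
exists r^-1 => [|y By yx]; first by rewrite invr_gt0.
have lyx : lspan B (y - x).
  by rewrite addrC -scaleN1r; have [_] := lspan_subspace B; apply.
have /(dilateS Br) := gauge_lt cB B0 lyx yx.
rewrite dilate_dilate mulVf ?gt_eqF// dilate1 => /VU /=.
by rewrite addrC subrK.
Qed.

(** A bounded set that contains all [2 ^ n x] contains, up to absolutely
    convex hull, the line spanned by [x]. This is the trace on the bornology
    of the Hausdorff property, and it is all that gauges need to be norms. *)
Definition line_free b :=
  forall A x, b A -> (forall n, A (rs (2 ^+ n) *: x)) -> x = 0.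

Lemma line_free_norming b A : line_free b -> b A -> absolutely_convex A ->
  A !=set0 -> norming_disk A.
Proof.
move=> lb bA cA A0; split=> // e Ae e0; apply: (lb A) => // n.
have p0 : 0 < 2 ^- n :> R by rewrite invr_gt0 exprn_gt0.
have /dilateV : dilate (2 ^- n) A e by apply: gauge_lt => //; rewrite e0.
by rewrite invrK; apply.
Qed.

Lemma hausdorff_line_free t :
  hausdorff_space (lcs t) -> line_free (bornology_of_topology t).
Proof.
move=> /lcs_hausdorffP ht A x bA Ax; apply/eqP; apply: contrapT => /negP/ht.
move=> [U /nbhs0_absolutely_convex[V [tV VU cV]]]; apply; apply: VU.
have [r r0 Ar] := (tvs_boundedP _ _).1 bA V tV cV.
have [n rn] := small_half r (@ltr01 R).
have /Ar/(dilateM (2 ^- n)) := Ax n.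
have n0 : (2 : R) ^+ n != 0 by rewrite expf_neq0.
rewrite scalerA -rmorphM mulVf// rmorph1 scale1r => Vx.
rewrite -[V]dilate1; apply: dilate_le Vx => //.
  by rewrite mulr_ge0// ?invr_ge0 ?exprn_ge0// ltW.
by rewrite mulrC ltW.
Qed.

Section InductiveTopology.
Variable D : nat -> set E.

Let ind : set_system E := [set U | exists V,
  [/\ V `<=` U, absolutely_convex V, forall n, absorbs V (D n) &
      forall x, absorbs V [set x]]].

Let ind_filter : Filter ind.
Proof.
split.
- have a1 A : absorbs [set: E] A.
    exists 1 => // c c1 x _; exists (c^-1 *: x) => //.
    by rewrite scalerA divff ?scale1r// -normr_gt0 (lt_le_trans ltr01).
  by exists setT; split.
- move=> P Q [U [UP cU aU pU]] [V [VQ cV aV pV]]; exists (U `&` V); split.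
  + exact: setISS.
  + exact: absolutely_convexI.
  + by move=> n; exact: absorbsI.
  + by move=> x; exact: absorbsI.
- move=> P Q PQ [V [VP cV aV pV]]; exists V; split=> //.
  exact: subset_trans VP PQ.
Qed.

Let ind_disk U : ind U -> exists V,
  [/\ ind V, V `<=` U, absolutely_convex V & forall x, absorbs V [set x]].
Proof. by move=> [V [VU cV aV pV]]; exists V; split=> //; exists V; split. Qed.

Let ind_scale (c : base_scalars R k) U :
  c != 0 -> ind U -> ind [set x | U (c *: x)].
Proof.
move=> c0 [V [VU cV aV pV]]; exists [set x | V (c *: x)]; split.
- by move=> x /VU.
- exact: absolutely_convexZ.
- by move=> n; exact: absorbsZ.
- by move=> x; exact: absorbsZ.
Qed.

(** The finest locally convex topology in which every [D n] is bounded. *)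
Definition inductive_topology : lc_topology E :=
  LcTopology ind_filter ind_disk ind_scale.

Lemma inductive_bounded n : tvs_bounded inductive_topology (D n).
Proof. by move=> U /nbhs0E[V [VU _ aV _]]; exact: absorbsS (aV n). Qed.

Hypothesis Dac : forall n, absolutely_convex (D n).
Hypothesis D0 : forall n, D n !=set0.
Hypothesis Dcover : forall x, exists n, lspan (D n) x.

Lemma inductive_nbhs0 V : absolutely_convex V ->
  (forall n, exists2 r, 0 < r & D n `<=` dilate r V) ->
  nbhs0 inductive_topology V.
Proof.
move=> cV aV; exists V; split=> //; first by move=> n; exact/absorbsP.
move=> x; apply/absorbsP => //; have [n /lspanP[]//l l0 Dx] := Dcover x.
have [r r0 Dr] := aV n; exists (l * r) => [|_ ->]; first exact: mulr_gt0.
by rewrite -dilate_dilate; exact: dilateS Dx.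
Qed.

Hypothesis DS : forall n, D n `<=` D n.+1.

(** If [A] were in no [n.+1 * closure (D n)], then points [x n] of [A] would
    give points [y n = x n / n.+1] outside [closure (D n)], hence
    neighbourhoods [V n] of [0] with [y n] outside [D n + V n]. The
    intersection of all [D n + V n] absorbs each [D m], because [D m] is
    contained in [D n] for [n >= m] and only finitely many [n] remain. It is
    thus a neighbourhood of [0] and absorbs [A], which contradicts the choice
    of the [y n]. *)
Lemma inductive_bounded_sub A : tvs_bounded inductive_topology A ->
  exists n, A `<=`
    dilate n.+1%:R (closure (D n : set (lcs inductive_topology))).
Proof.
move=> bA; apply: contrapT => nA.
have Dle := increasing_subset DS.
have /choice[x xP] n : exists x, A x /\
    ~ closure (D n : set (lcs inductive_topology)) (rs n.+1%:R^-1 *: x).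
  apply: contrapT => nx; apply: nA; exists n => x Ax.
  by apply/dilateV => //; apply: contrapT => ncl; apply: nx; exists x; split.
pose y n := rs n.+1%:R^-1 *: x n.
have /choice[V VP] n : exists V, [/\ nbhs0 inductive_topology V,
    absolutely_convex V & forall d, D n d -> ~ V (d - y n)].
  have [_ /nbhs0_closureP ncl] := xP n; apply: contrapT => nV; apply: ncl.
  move=> U /nbhs0_absolutely_convex[V [tV VU cV]].
  apply: contrapT => nU; apply: nV; exists V; split=> // d Dd Vd.
  by apply: nU; exists d => //; exact: VU.
pose W : set E := [set w | forall n, exists2 d, D n d & V n (w - d)].
have cW : absolutely_convex W.
  move=> a c u v ac Wu Wv n; have [d Dd Vd] := Wu n; have [e De Ve] := Wv n.
  have [_ cV _] := VP n; exists (a *: d + c *: e); first exact: Dac.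
  have -> : a *: u + c *: v - (a *: d + c *: e) = a *: (u - d) + c *: (v - e).
    by rewrite !scalerBr opprD addrACA.
  exact: cV.
have tW : nbhs0 inductive_topology W.
  apply: inductive_nbhs0 => // m.
  have /choice[r rP] n : exists r, 0 < r /\ D m `<=` dilate r (V n).
    have [tV cV _] := VP n.
    have [r r0 Dr] := (tvs_boundedP _ _).1 (inductive_bounded m) _ tV cV.
    by exists r.
  (* [s] dominates the finitely many radii [r n], [n < m], and also [1]. *)
  pose s := 1 + \sum_(n < m) r n.
  have s1 : 1 <= s by rewrite lerDl sumr_ge0// => n _; exact: ltW (rP n).1.
  have s0 : 0 < s := lt_le_trans ltr01 s1.
  exists s => // u Du; apply/dilateV => // n; have [mn|nm] := leqP m n.
    exists (rs s^-1 *: u); last by rewrite subrr; have [/nbhs00] := VP n.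
    apply: (Dle _ _ mn); apply: absolutely_convex_balanced => //.
    by rewrite norm_rs gtr0_norm ?invr_gt0// -(rmorph1 rs) ler_rs invf_le1.
  exists 0; first exact: absolutely_convex0.
  have [_ cV _] := VP n; rewrite subr0; apply/dilateV => //.
  apply: (dilate_le cV _ _ ((rP n).2 _ Du)); first exact: ltW (rP n).1.
  rewrite /s (bigD1 (Ordinal nm))//= addrCA lerDl addr_ge0// sumr_ge0// => j _.
  exact: ltW (rP j).1.
have [r r0 Ar] := (tvs_boundedP _ _).1 bA W tW cW.
pose n := Num.bound r.
have /(dilate_le cW (ltW r0)) : r <= n.+1%:R.
  by rewrite ltW// (lt_le_trans (archi_boundP (ltW r0)))// ler_nat.
move=> /(_ _ (Ar _ (xP n).1)) /dilateV => /(_ (ltr0Sn _ _)) /(_ n)[d Dd].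
have [_ cV /(_ d Dd)] := VP n; rewrite -opprB => nV Vd; apply: nV.
by rewrite -[V n]dilate1; apply: dilateN => //; rewrite dilate1.
Qed.

End InductiveTopology.

Lemma lc_topology_ext s t : nbhs0 s = nbhs0 t -> s = t.
Proof.
case: s t => [s s1 s2 s3] [t t1 t2 t3] /= st; case: _ / st t1 t2 t3 => *.
by congr LcTopology; exact: Prop_irrelevance.
Qed.

End Topologies.

(** * Separation by linear functionals *)

Section RealHahnBanach.
Context {R : realType} {k : base_field} {E : lmodType (base_scalars R k)}.
Local Notation rs := (@real_scalar R k).
Variables (p : E -> R) (e : E).
Hypothesis pD : forall x y, p (x + y) <= p x + p y.
Hypothesis pZ : forall a x, 0 <= a -> p (rs a *: x) = a * p x.

Let p0 : p 0 = 0.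
Proof. by rewrite -(scaler0 _ (rs 0)) pZ// mul0r. Qed.

(** Graphs of real linear forms on subspaces containing [e] that are dominated
    by [p]. The domination at [0] makes such a set functional, and the last
    clause admits the empty set, which is the union of the empty chain. *)
Let good (G : set (E * R)) := [/\
  forall a z w, G z -> G w -> G (rs a *: z.1 + w.1, a * z.2 + w.2),
  forall z, G z -> z.2 <= p z.1 & G !=set0 -> G (e, p e)].

Let good0 : good [set z | exists a, z = (rs a *: e, a * p e)].
Proof.
split=> [a _ _ [u ->] [v ->]|_ [a ->]|_] /=.
- exists (a * u + v); rewrite scalerA -scalerDl -rmorphM -rmorphD.
  by rewrite mulrDl mulrA.
- have [a0|a0] := leP 0 a; first by rewrite pZ.
  have := pD (rs a *: e) (rs (- a) *: e).
  rewrite -scalerDl -rmorphD subrr rmorph0 scale0r p0.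
  by rewrite [p (rs (- a) *: e)]pZ ?oppr_ge0 ?(ltW a0)// mulNr subr_ge0.
- by exists 1; rewrite rmorph1 scale1r mul1r.
Qed.

Let good_bigcup (F : set (set (E * R))) : F `<=` good -> total_on F subset ->
  good (\bigcup_(X in F) X).
Proof.
move=> Fg Ft; split=> [a z w [X FX Xz] [Y FY Yw]|z [X FX Xz]|[z [X FX Xz]]].
- have [XY|YX] := Ft _ _ FX FY.
    by exists Y => //; have [h _ _] := Fg _ FY; apply: h => //; exact: XY.
  by exists X => //; have [h _ _] := Fg _ FX; apply: h => //; exact: YX.
- by have [_ h _] := Fg _ FX; exact: h.
- by exists X => //; have [_ _] := Fg _ FX; apply; exists z.
Qed.

(** A maximal good graph [A] is total: it could otherwise be extended at a
    missing point [x] by any value [c] between the numbers [s - p (y - x)] and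
    the numbers [p (y + x) - s] for [(y, s)] in [A]. *)
Lemma real_hahn_banach : exists f : E -> R,
  [/\ forall a x y, f (rs a *: x + y) = a * f x + f y,
      forall x, f x <= p x & f e = p e].
Proof.
have [A [[Alin Ap Ae] Amax]] := Zorn_bigcup good_bigcup.
have A0 : A !=set0.
  apply/set0P/eqP => A0; apply: (Amax _ _ good0); rewrite A0; split=> //.
  by move=> /(_ (0, 0)); apply; exists 0; rewrite rmorph0 scale0r mul0r.
have A00 : A (0, 0).
  have [z Az] := A0; have := Alin (-1) z z Az Az.
  by rewrite rmorphN1 scaleN1r mulN1r !addNr.
have AD z w : A z -> A w -> A (z.1 + w.1, z.2 + w.2).
  by move=> Az Aw; have := Alin 1 z w Az Aw; rewrite rmorph1 scale1r mul1r.
have AZ a z : A z -> A (rs a *: z.1, a * z.2).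
  by move=> Az; have := Alin a z (0, 0) Az A00; rewrite /= !addr0.
have Afun x r s : A (x, r) -> A (x, s) -> r <= s.
  move=> xr xs; have := Ap _ (Alin (-1) _ _ xs xr) => /=.
  by rewrite rmorphN1 scaleN1r addNr p0 mulN1r addrC subr_le0.
suff /choice[f fA] : forall x, exists r, A (x, r).
  have fE x r : A (x, r) -> f x = r.
    by move=> xr; apply/eqP; rewrite eq_le !(Afun x).
  exists f; split=> [a x y|x|]; [|exact: Ap (fA x)|exact/fE/Ae].
  by apply: fE; exact: Alin a _ _ (fA x) (fA y).
move=> x; apply: contrapT => nx.
have key z w : A z -> A w -> z.2 - p (z.1 - x) <= p (w.1 + x) - w.2.
  move=> Az Aw; rewrite lerBrDr addrAC lerBlDr addrC.
  rewrite (le_trans (Ap _ (AD _ _ Aw Az)))//= (le_trans _ (pD _ _))//.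
  by rewrite addrACA subrr addr0.
pose S := [set z.2 - p (z.1 - x) | z in A].
have S0 : S !=set0 by exists (0 - p (0 - x)); exists (0, 0).
pose c := sup S.
have lc z : A z -> z.2 - p (z.1 - x) <= c.
  move=> Az; apply: ub_le_sup; last by exists z.
  by exists (p (0 + x) - 0) => _ [w Aw <-]; exact: (key w (0, 0)).
have cr z : A z -> c <= p (z.1 + x) - z.2.
  by move=> Az; apply: ge_sup => // _ [w Aw <-]; exact: key.
pose B := [set w | exists z t, A z /\ w = (z.1 + rs t *: x, z.2 + t * c)].
have AB : A `<=` B.
  move=> [y s] As; exists (y, s), 0.
  by rewrite rmorph0 scale0r mul0r !addr0.
have nBA : ~ B `<=` A.
  move=> BA; apply: nx; exists c; apply: BA; exists (0, 0), 1.
  by rewrite rmorph1 scale1r mul1r !add0r.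
apply: (Amax B) => //; split=> [a _ _ [z [s [Az ->]]] [w [t [Aw ->]]]||_] /=.
- exists (rs a *: z.1 + w.1, a * z.2 + w.2), (a * s + t); split.
    exact: Alin.
  rewrite /= rmorphD rmorphM scalerDr scalerDl scalerA mulrDr mulrDl mulrA.
  by rewrite !addrA ![_ + _ + w.1]addrAC ![_ + _ + w.2]addrAC.
- move=> _ [z [t [Az ->]]] /=; have [t0|t0|->] := ltgtP t 0; last first.
  + by rewrite rmorph0 scale0r mul0r !addr0; exact: Ap.
  + have := cr _ (AZ t^-1 _ Az) => /=.
    rewrite -(ler_pM2l t0) mulrBr mulrA divff ?gt_eqF// mul1r -pZ ?(ltW t0)//.
    rewrite scalerDr scalerA -rmorphM divff ?gt_eqF// rmorph1 scale1r.
    by rewrite lerBrDr addrC.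
  + have u0 : 0 < - t by rewrite oppr_gt0.
    have := lc _ (AZ (- t)^-1 _ Az) => /=.
    rewrite -(ler_pM2l u0) mulrBr mulrA divff ?gt_eqF// mul1r -pZ ?(ltW u0)//.
    rewrite scalerBr scalerA -rmorphM divff ?gt_eqF// rmorph1 scale1r.
    by rewrite rmorphN scaleNr opprK mulNr lerBlDr addrC lerBrDr addrC.
- by apply: AB; exact: Ae.
Qed.

End RealHahnBanach.

(** Over the complex numbers the form is [f x - i f (i x)], which is complex
    linear with real part [f]; the factor [2] bounds the two terms crudely. *)
Lemma complexification {R : realType} {k : base_field}
    {E : lmodType (base_scalars R k)} (f p : E -> R) (e : E) :
  (forall a x y, f (real_scalar k a *: x + y) = a * f x + f y) ->
  (forall x, `|f x| <= p x) ->
  (forall (c : base_scalars R k) x, `|c| <= 1 -> p (c *: x) <= p x) ->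
  f e != 0 ->
  exists F : {scalar E},
    F e != 0 /\ forall x, `|F x| <= real_scalar k (2 * p x).
Proof.
move=> fl fp pZ fe; have p_ge0 x : 0 <= p x := le_trans (normr_ge0 _) (fp x).
case: k E f p e fl fp pZ fe p_ge0 => /= E f p e fl fp pZ fe p_ge0.
  pose L := GRing.isLinear.Build _ _ _ _ f fl.
  pose F : {scalar E} := HB.pack f L.
  exists F; split=> // x; rewrite (le_trans (fp x))//.
  by rewrite ler_peMl// ler1n.
pose g (x : E) : R[i]%C := (f x +i* - f ('i%C *: x))%C.
have fZ (a : R) x : f (a%:C%C *: x) = a * f x.
  have f0 : f 0 = 0.
    have := fl (-1) 0 0; rewrite scaler0 addr0 mulN1r => ->.
    by rewrite addNr.
  by have := fl a x 0; rewrite !addr0 f0 addr0.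
have fD x y : f (x + y) = f x + f y.
  by have := fl 1 x y; rewrite rmorph1 scale1r mul1r.
have gl : scalable_for *%R g /\ {morph g : x y / x + y}.
  split=> [[a b] x|x y]; last first.
    by rewrite /g scalerDr !fD opprD; apply/eqP; rewrite eq_complex /= !eqxx.
  have cE : (a +i* b)%C = a%:C%C + b%:C%C * 'i%C.
    by apply/eqP; rewrite eq_complex /=; apply/andP; split; apply/eqP; ring.
  have iE : 'i%C * (a +i* b)%C = a%:C%C * 'i%C + (- b)%:C%C :> R[i]%C.
    by apply/eqP; rewrite eq_complex /=; apply/andP; split; apply/eqP; ring.
  rewrite /g scalerA iE cE !scalerDl -!scalerA !fD !fZ.
  by apply/eqP; rewrite eq_complex /=; apply/andP; split; apply/eqP; ring.
pose L := GRing.isLinear.Build _ _ _ _ g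
  (fun a x y => etrans (gl.2 _ _) (congr1 (+%R^~ _) (gl.1 a x))).
pose F : {scalar E} := HB.pack g L.
exists F; split=> [|x].
  by rewrite /= /g eq_complex negb_and fe.
have -> : F x = (f x)%:C%C - 'i%C * (f ('i%C *: x))%:C%C :> R[i]%C.
  by apply/eqP; rewrite eq_complex /=; apply/andP; split; apply/eqP; ring.
rewrite (le_trans (ler_normB _ _))// normrM normCi mul1r.
have nr (r : R) : `|r%:C%C| = `|r|%:C%C :> R[i]%C := norm_rs ComplexField r.
rewrite !nr -rmorphD /= lecR mulrDl mul1r lerD//.
by rewrite (le_trans (fp _))// pZ// normCi.
Qed.

Section Separation.
Context {R : realType} {k : base_field} {E : lmodType (base_scalars R k)}.
Local Notation K := (base_scalars R k).
Local Notation rs := (@real_scalar R k).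

(** The gauge of [V] is at least [1] at [e], and the Hahn-Banach theorem
    yields a form dominated by the gauge that has the same value at [e]. *)
Lemma disk_separation (V : set E) (e : E) : absolutely_convex V ->
  (forall x, absorbs V [set x]) -> ~ V e ->
  exists F : {scalar E}, F e != 0 /\ forall x, V x -> `|F x| <= rs 2.
Proof.
move=> cV aV nVe; have aVP x := (absorbsP cV [set x]).1 (aV x).
have V0 : V !=set0.
  have [r r0 /(_ 0 erefl)] := aVP 0; move=> [v Vv _]; by exists v.
have lV x : lspan V x.
  by apply/lspanP => //; have [r r0 /(_ x erefl) Vx] := aVP x; exists r.
pose p := @Defs.minkowski R k E V.
have pZ (c : K) r x : `|c| = rs r -> p (c *: x) = r * p x.
  by move=> cr; exact: gaugeZ.
have pZr a x : 0 <= a -> p (rs a *: x) = a * p x.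
  by move=> a0; apply: pZ; rewrite norm_rs ger0_norm.
have pN x : p (- x) = p x.
  by rewrite -scaleN1r (pZ _ 1) ?mul1r// normrN1 rmorph1.
have pD x y : p (x + y) <= p x + p y by exact: gaugeD.
have [f [fl fp fe]] := real_hahn_banach e pD pZr.
have f0 : f 0 = 0.
  have := fl (-1) 0 0; rewrite rmorphN1 scaleN1r addNr mulN1r addNr.
  by [].
have fN x : f (- x) = - f x.
  by have := fl (-1) x 0; rewrite rmorphN1 scaleN1r addr0 f0 addr0 mulN1r.
have [|||F [Fe FV]] := @complexification _ _ _ f p e fl.
- by move=> x; rewrite ler_norml fp andbT lerNl -fN -pN.
- move=> c x; have [r r0 cr] := norm_realP c.
  rewrite cr -(rmorph1 rs) ler_rs => r1; rewrite (pZ _ _ _ cr).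
  by rewrite ler_piMl// gauge_ge0.
- rewrite fe gt_eqF// (@lt_le_trans _ _ 1)// leNgt; apply/negP => pe.
  apply: nVe; rewrite -[V]dilate1; exact: gauge_lt.
exists F; split=> // x Vx; rewrite (le_trans (FV x))// ler_rs.
by rewrite -[leRHS]mulr1 ler_pM2l// gauge_le// dilate1.
Qed.

End Separation.

(** * Factorization through an increasing sequence of complete disks *)

Section Factorization.
Context {R : realType} {k : base_field} {E : lmodType (base_scalars R k)}.
Local Notation rs := (@real_scalar R k).
Implicit Types (A B D : set E) (Q : nat -> set E).

(** The Baire category theorem for the normed space spanned by [A]. If every
    ball contained a smaller one that misses [Q n], then nested balls with
    radii at least halved at each step would have a common point, in no [Q
    n]. *)
Lemma fast_complete_baire A Q : absolutely_convex A -> A !=set0 ->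
  fast_complete A -> (forall x, exists n, Q n x) ->
  exists n x0 (e : R), 0 < e /\ forall x d, dilate e A (x - x0) -> 0 < d ->
    exists2 q, Q n q & dilate d A (q - x).
Proof.
move=> cA A0 fA coverQ; apply: contrapT => nQ.
have /choice[step stepP] : forall z : nat * (E * R), exists w : E * R,
    0 < z.2.2 -> [/\ dilate z.2.2 A (w.1 - z.2.1), 0 < w.2, w.2 <= z.2.2 / 2 &
      forall q, Q z.1 q -> ~ dilate (4 * w.2) A (q - w.1)].
  move=> [n [x e]] /=; have [e0|e0] := ltP 0 e; last by exists (x, e).
  have [y [d [yx d0 yQ]]] : exists y d, [/\ dilate e A (y - x), 0 < d &
      forall q, Q n q -> ~ dilate d A (q - y)].
    apply: contrapT => ny; apply: nQ; exists n, x, e; split=> // y d yx d0.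
    by apply: contrapT => nq; apply: ny; exists y, d; split=> // q Qq qy;
      apply: nq; exists q.
  (* [d / 4] makes four times the new radius at most [d], which is the bound
     given by [fast_complete] for the distance to the common point. *)
  exists (y, Num.min (e / 2) (d / 4)) => _ /=; split=> //.
  - by rewrite lt_min !divr_gt0.
  - by rewrite ge_min lexx.
  - move=> q Qq yq; apply: (yQ q Qq); apply: dilate_le yq => //.
      by rewrite mulr_ge0// le_min !divr_ge0// ltW.
    by rewrite mulrC -ler_pdivlMr// ge_min lexx orbT.
pose Z := fix Z n := if n is m.+1 then step (m, Z m) else (0 : E, 1 : R).
have Z0 n : 0 < (Z n).2.
  by elim: n => [|n IH] //=; have [] := stepP (n, Z n) IH.
have ZP n := stepP (n, Z n) (Z0 n).
have /choice[v vP] n : exists v, A v /\ rs (Z n).2 *: v = (Z n.+1).1 - (Z n).1.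
  by have [[v Av vZ] _ _ _] := ZP n; exists v.
have [||s sP] := fA (fun n => (Z n).2) v Z0; first by move=> n; have [] := ZP n.
  by move=> n; exact: (vP n).1.
have Zsum n : \sum_(i < n) rs (Z i).2 *: v i = (Z n).1.
  elim: n => [|n IH]; first by rewrite big_ord0.
  by rewrite big_ord_recr/= IH (vP n).2 addrC subrK.
have [n Qs] := coverQ s; have [_ _ _ /(_ s Qs)] := ZP n; apply.
by have := sP n.+1; rewrite Zsum.
Qed.

(** Successive approximation, as in the open mapping theorem: [z] is the
    limit, for the gauge of [A], of a series that converges in the span of [D]
    to some [s]. The two limits agree because [z - s] belongs to all the
    multiples by [2 ^- n] of one bounded set. *)
Lemma open_mapping_disk (b : convex_bornology E) A D (e M : R) : line_free b ->
  b A -> b D -> absolutely_convex A -> absolutely_convex D -> fast_complete D ->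
  0 < e -> 0 < M ->
  (forall x, dilate e A x ->
    exists2 q, dilate M D q & dilate (e / 2) A (x - q)) ->
  dilate e A `<=` dilate (4 * M) D.
Proof.
move=> lb bA bD cA cD fD e0 M0 approx z Az.
have /choice[q qP] : forall x, exists q, dilate e A x ->
    dilate M D q /\ dilate (e / 2) A (x - q).
  move=> x; have [/approx[q Dq xq]|nx] := pselect (dilate e A x).
    by exists q.
  by exists 0.
pose Z := fix Z n := if n is m.+1 then rs 2 *: (Z m - q (Z m)) else z.
have AZ n : dilate e A (Z n).
  elim: n => [|n IH] //=; have [_ /(dilateM 2)] := qP _ IH.
  by rewrite mulrC divfK.
have /choice[v vP] n : exists v, D v /\ rs M *: v = q (Z n).
  by have [[v Dv vq] _] := qP _ (AZ n); exists v.
have [|||s sP] := fD (fun n => M / 2 ^+ n) v.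
- by move=> n; rewrite divr_gt0// exprn_gt0.
- by move=> n; rewrite exprSr invfM mulrA.
- by move=> n; exact: (vP n).1.
have zE n : z = \sum_(i < n) rs (M / 2 ^+ i) *: v i + rs (2 ^- n) *: Z n.
  elim: n => [|n IH].
    by rewrite big_ord0 add0r expr0 invr1 rmorph1 scale1r.
  rewrite big_ord_recr/= -addrA {1}IH; congr (_ + _).
  rewrite scalerA -rmorphM exprSr invfM -mulrA mulVf// mulr1.
  by rewrite mulrC rmorphM -scalerA (vP n).2 scalerBr addrC subrK.
suff zs : z = s by have := sP 0%N; rewrite big_ord0 subr0 expr0 divr1 zs.
apply/eqP; rewrite -subr_eq0; apply/eqP.
apply: (lb [set x + y | x in dilate e A & y in dilate (4 * M) D]).
  by apply: bornologyD; exact: bornologyZ.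
move=> n; exists (Z n) => //; exists (- (rs (2 ^+ n) *:
    (s - \sum_(i < n) rs (M / 2 ^+ i) *: v i))).
  apply: dilateN => //; have -> : 4 * M = 2 ^+ n * (4 * (M / 2 ^+ n)).
    by rewrite mulrCA [2 ^+ n * _]mulrC divfK// expf_neq0.
  exact: dilateM.
rewrite [in RHS](zE n) -scalerN opprB [in RHS]addrAC [in RHS]scalerDr.
rewrite scalerA -rmorphM.
by rewrite divff ?expf_neq0// rmorph1 scale1r [LHS]addrC.
Qed.

(** By the Baire category theorem some multiple of [D n] is dense in a ball of
    the span of [A]; by symmetry it can be centred at [0], up to doubling the
    multiple, and the open mapping argument turns density into inclusion. *)
Lemma grothendieck_factorization (b : convex_bornology E) A (D : nat -> set E) :
  line_free b -> b A -> absolutely_convex A -> A !=set0 -> fast_complete A ->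
  (forall n, b (D n)) -> (forall n, absolutely_convex (D n)) ->
  (forall n, D n !=set0) -> (forall n, fast_complete (D n)) ->
  (forall n, D n `<=` D n.+1) -> (forall x, exists n, lspan (D n) x) ->
  exists n, exists2 r, 0 < r & A `<=` dilate r (D n).
Proof.
move=> lb bA cA A0 fA bD cD D0 fD DS coverD.
have Dle := increasing_subset DS.
have [|n [x0 [e [e0 dense]]]] :=
    @fast_complete_baire A (fun n => dilate n.+1%:R (D n)) cA A0 fA.
  move=> x; have [n /(lspanP (cD n) (D0 n))[l l0 Dx]] := coverD x.
  pose m := maxn n (Num.bound l); exists m.
  apply: (@dilate_le _ _ _ _ (cD m) l); first exact: ltW.
    rewrite ltW// (lt_le_trans (archi_boundP (ltW l0)))// ler_nat.
    by rewrite leqW// leq_maxr.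
  by apply: dilateS Dx; apply: Dle; rewrite leq_maxl.
have A00 : dilate e A 0.
  by exists 0; rewrite ?scaler0//; exact: absolutely_convex0.
have e4 : 0 < e / 4 by rewrite divr_gt0.
pose M : R := n.+1%:R + n.+1%:R.
have M0 : 0 < M by rewrite addr_gt0.
have Me : dilate e A `<=` dilate (4 * M) (D n).
  apply: (@open_mapping_disk b) => // x Ax.
  have [|p Dp px] := dense (x + x0) _ _ e4; first by rewrite addrK.
  have [|q Dq qx] := dense x0 _ _ e4; first by rewrite subrr.
  exists (p - q); first by apply: dilateD => //; exact: dilateN.
  have -> : x - (p - q) = - (p - (x + x0)) + (q - x0).
    by rewrite !opprB [RHS](AC (3*2) ((1*(4*3))*(2*5)))/= subrr addr0.
  have -> : e / 2 = e / 4 + e / 4 by lra.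
  by apply: dilateD => //; [exact: ltW|exact: ltW|exact: dilateN].
exists n, (e^-1 * (4 * M)); first by rewrite mulr_gt0 ?invr_gt0// mulr_gt0.
move=> x Ax; rewrite -dilate_dilate; apply/(dilateS Me).
by rewrite dilate_dilate mulVf ?gt_eqF// dilate1.
Qed.

End Factorization.

(** * The Banach space spanned by a Banach disk *)

Section Subspace.
Context {K : numFieldType} {E : lmodType K}.

(** Subspaces as types, so that they can carry a topology of their own. *)
Definition subspace_type (P : set E) (lP : linear_subspace P) : Type :=
  {x : E | x \in P}.

Variables (P : set E) (lP : linear_subspace P).

HB.instance Definition _ := SubChoice.on (subspace_type lP).

Let P_submod_closed : submod_closed [pred x : E | x \in P].
Proof.
split=> [|a x y]; rewrite !inE; first exact: lP.1.
by move=> Px Py; exact: lP.2.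
Qed.

HB.instance Definition _ := GRing.SubChoice_isSubLmodule.Build K E
  [pred x | x \in P] (subspace_type lP) P_submod_closed.

Definition subspace_val : subspace_type lP -> E := val.

HB.instance Definition _ := GRing.Linear.on subspace_val.

Lemma subspace_valP (x : subspace_type lP) : P (subspace_val x).
Proof. by have := valP x; rewrite inE. Qed.

Lemma subspace_val_inj : injective subspace_val.
Proof. exact: val_inj. Qed.

Lemma subspace_valK x : P x -> exists y : subspace_type lP, subspace_val y = x.
Proof. by move=> Px; exists (exist _ x (mem_set Px)). Qed.

End Subspace.

(** * Continuity of linear maps *)

Section TvsNeighbourhoods.
Context {K : numFieldType} (S : tvsType K).

(** Local convexity provides a convex neighbourhood [C]; the points whose
    multiples by scalars of norm at most [1] all lie in [C] form a balanced
    convex set, and the continuity of the scaling at [0] makes it a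
    neighbourhood. *)
Lemma tvs_nbhs0_absolutely_convex (U : set S) : nbhs 0 U ->
  exists W : set S, [/\ nbhs 0 W, W `<=` U & absolutely_convex (W : set S)].
Proof.
move=> U0; have [B Bconv [Bopen Bbasis]] := @locally_convex K S.
have [C [BC C0] CU] := Bbasis 0 U U0.
have nC : nbhs 0 C by apply: open_nbhs_nbhs; split=> //; exact: Bopen.
have := @scale_continuous K S (0, 0) C; rewrite /= scaler0 => /(_ nC).
move=> [[B1 B2] /= [/nbhs_ballP[d /= d0 dB1] nB2] BC'].
pose W : set S := [set x | forall a : K, `|a| <= 1 -> C (a *: x)].
have d2 : 0 < d / 2 by rewrite divr_gt0.
exists W; split.
- apply: filterS (nbhs0Z (lt0r_neq0 d2) nB2) => _ [x Bx <-] a a1.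
  rewrite scalerA; apply: (BC' (a * (d / 2), x)); split=> //=.
  apply: dB1; rewrite /ball/= sub0r normrN normrM (gtr0_norm d2).
  apply: (le_lt_trans (ler_wpM2r (ltW d2) a1)); rewrite mul1r.
  by rewrite ltr_pdivrMr// ltr_pMr// ltr1n.
- by move=> x Wx; apply: CU; have := Wx 1; rewrite normr1 scale1r; apply.
move=> a c x y ac Wx Wy u u1.
have a1 : `|a| <= 1 by rewrite (le_trans _ ac)// lerDl.
have ca : `|c| <= 1 - `|a| by rewrite lerBrDr addrC.
pose l : {i01 K} := Itv01 (normr_ge0 a) a1.
have Cx : C ((u * a / `|a|) *: x).
  apply: Wx; have [->|a0] := eqVneq a 0; first by rewrite mulr0 mul0r normr0.
  by rewrite !normrM normfV normr_id mulfK ?normr_eq0.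
have Cy : C ((u * c / (1 - `|a|)) *: y).
  apply: Wy; rewrite !normrM normfV (ger0_norm (le_trans (normr_ge0 c) ca)).
  have [->|a0] := eqVneq (1 - `|a|) 0; first by rewrite invr0 mulr0.
  rewrite ler_pdivrMr ?mul1r; last first.
    by rewrite lt_neqAle eq_sym a0 subr_ge0.
  by rewrite (le_trans _ ca)// ler_piMl.
have := Bconv C (mem_set BC) _ _ l (mem_set Cx) (mem_set Cy).
rewrite inE; congr (C _).
transitivity (`|a| *: ((u * a / `|a|) *: x) +
  (1 - `|a|) *: ((u * c / (1 - `|a|)) *: y)); first by [].
rewrite scalerDr !scalerA; congr (_ *: _ + _ *: _).
  have [->|a0] := eqVneq a 0; first by rewrite normr0 mulr0 !mul0r.
  by rewrite mulrC divfK// normr_eq0.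
have [a0|a0] := eqVneq (1 - `|a|) 0; last by rewrite mulrC divfK.
by move: ca; rewrite a0 normr_le0 => /eqP ->; rewrite mulr0 !mul0r.
Qed.

Lemma tvs_nbhs_shift (x : S) (U : set S) :
  nbhs x U -> nbhs 0 [set u | U (x + u)].
Proof.
move=> /(nbhsB (- x)); rewrite addNr; apply: filterS => _ [u Uu <-] /=.
by rewrite addrA subrr add0r.
Qed.

Lemma lcs_linear_continuous (E : lmodType K) (t : lc_topology E)
    (h : lcs t -> S) : {morph h : x y / x + y} ->
  (forall U, nbhs 0 U -> nbhs0 t (h @^-1` U)) -> continuous h.
Proof.
move=> hD h0 x U /tvs_nbhs_shift/h0; rewrite -[nbhs (h @ x) U]/(nbhs x _).
rewrite nbhs_lcsE; apply: (@filterS _ _ (nbhs0_filter t)) => u /=.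
by rewrite hD.
Qed.

End TvsNeighbourhoods.

Section NormedContinuity.
Context {R : realType} {k : base_field}.
Local Notation K := (base_scalars R k).
Local Notation rs := (@real_scalar R k).

Lemma normed_linear_continuousP (F : normedModType K) (S : tvsType K)
    (g : {linear F -> S}) : continuous g <->
  forall U : set S, nbhs 0 U ->
    exists2 e : R, 0 < e & forall x, `|x| < rs e -> U (g x).
Proof.
split=> [gc U U0|h x U /tvs_nbhs_shift/h[e e0 eU]].
  have := gc 0 U; rewrite linear0 => /(_ U0)/nbhs_ballP.
  move=> [_ /pos_realP[e e0 ->] eU].
  by exists e => // x xe; apply: eU; rewrite -ball_normE/= sub0r normrN.
apply/nbhs_ballP; exists (rs e); first by rewrite /= rs_gt0.
move=> y; rewrite -ball_normE/= distrC => /eU /=.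
by rewrite linearB addrC subrK.
Qed.

End NormedContinuity.

Section BanachType.
Context {R : realType} {k : base_field} {E : lmodType (base_scalars R k)}.
Local Notation K := (base_scalars R k).
Local Notation rs := (@real_scalar R k).
Local Notation gauge := (@Defs.minkowski R k E).

Definition banach_type (B : set E) (hB : banach_disk B) : Type :=
  subspace_type (lspan_subspace B).

Variables (B : set E) (hB : banach_disk B).

HB.instance Definition _ := GRing.Lmodule.on (banach_type hB).

Definition banach_val : banach_type hB -> E := @subspace_val _ _ _ _.

HB.instance Definition _ := GRing.Linear.on banach_val.

Let cB : absolutely_convex B. Proof. by case: hB => -[]. Qed.
Let B0 : B !=set0. Proof. by case: hB => -[]. Qed.

Lemma banach_valP (x : banach_type hB) : lspan B (banach_val x).
Proof. exact: subspace_valP. Qed.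

Let norm (x : banach_type hB) : K := rs (gauge B (banach_val x)).

Let normD x y : norm (x + y) <= norm x + norm y.
Proof.
by rewrite /norm -rmorphD ler_rs linearD gaugeD//; exact: banach_valP.
Qed.

Let normZ (c : K) x : norm (c *: x) = `|c| * norm x.
Proof.
have [r r0 cr] := norm_realP c.
by rewrite /norm linearZ/= (gaugeZ cB B0 (banach_valP x) cr) cr rmorphM.
Qed.

Let norm_eq0 x : norm x = 0 -> x = 0.
Proof.
move=> /eqP; rewrite rs_eq0 => /eqP x0; have [[_ _ h] _] := hB.
apply: subspace_val_inj; rewrite linear0.
by apply: h x0; exact: banach_valP.
Qed.

HB.instance Definition _ :=
  Lmodule_isNormed.Build K (banach_type hB) normD normZ norm_eq0.

Lemma banach_normE (x : banach_type hB) : `|x| = rs (gauge B (banach_val x)).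
Proof. by []. Qed.

Let banach_complete (F : set_system (banach_type hB)) :
  ProperFilter F -> cauchy F -> cvg F.
Proof.
move=> PF /cauchyP Fc.
have p0 n : 0 < 2 ^- n :> R by rewrite invr_gt0 exprn_gt0.
have /choice[x xF] n : exists x, F (ball x (rs (2 ^- n))).
  by apply: Fc; rewrite rs_gt0.
have ballE (y z : banach_type hB) (e : R) :
    ball y (rs e) z <-> gauge B (banach_val y - banach_val z) < e.
  by rewrite -ball_normE/= banach_normE linearB ltr_rs.
have xc m n : gauge B (banach_val (x m) - banach_val (x n)) < 2 ^- m + 2 ^- n.
  have [z [zm zn]] := filter_ex (filterI (xF m) (xF n)).
  rewrite -ballE rmorphD; apply: ball_triangle zm _; exact: ball_sym.
have small (e : R) : 0 < e -> exists n, forall m, (n <= m)%N -> 2 ^- m < e.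
  move=> e0; have [n] := small_half 1 e0; rewrite mul1r => ne; exists n => m nm.
  apply: le_lt_trans ne; rewrite lef_pV2 ?posrE ?exprn_gt0//.
  by rewrite ler_weXn2l// ler1n.
have [_ /(_ (fun n => banach_val (x n)))] := hB.
move=> [n|e e0|l Bl xl]; first exact: banach_valP.
  have [|N Ne] := small (e / 2); first by rewrite divr_gt0.
  exists N => m n Nm Nn; rewrite (lt_trans (xc m n))// [e]splitr.
  by rewrite ltrD// Ne.
have [y yl] := subspace_valK (lspan_subspace B) Bl; subst l.
apply/cvg_ex; exists (y : banach_type hB); apply/cvg_ballP => e.
move=> /pos_realP[d d0 ->{e}].
have d2 : 0 < d / 2 by rewrite divr_gt0.
have [N Nd] := small _ d2.
have /cvgrPdist_lt/(_ _ d2)[M _ Md] := xl.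
pose n := maxn M N.
apply: filterS (xF n) => z xz; rewrite [d]splitr rmorphD.
apply: (@ball_triangle _ _ (x n)).
  apply: ball_sym; apply/ballE; have := Md n (leq_maxl _ _).
  by rewrite sub0r normrN ger0_norm ?gauge_ge0.
apply: le_ball xz; rewrite ler_rs ltW// Nd//; exact: leq_maxr.
Qed.

HB.instance Definition _ :=
  Uniform_isComplete.Build (banach_type hB) banach_complete.

End BanachType.

(** * Inductive limits of Banach disks are LB-spaces *)

Section BanachInclusion.
Context {R : realType} {k : base_field} {E : lmodType (base_scalars R k)}.
Local Notation K := (base_scalars R k).
Local Notation rs := (@real_scalar R k).
Local Notation gauge := (@Defs.minkowski R k E).

Lemma lspanS (A B : set E) : A `<=` B -> lspan A `<=` lspan B.
Proof.
by move=> AB x Ax S [lS BS]; apply: Ax; split=> //; exact: subset_trans BS.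
Qed.

Section Inclusion.
Variables (A B : set E) (hA : banach_disk A) (hB : banach_disk B).
Hypothesis AB : lspan A `<=` lspan B.

Definition banach_incl (x : banach_type hA) : banach_type hB :=
  exist _ (banach_val x) (mem_set (AB (banach_valP x))).

Lemma banach_val_incl x : banach_val (banach_incl x) = banach_val x.
Proof. by []. Qed.

Fact banach_incl_linear : linear banach_incl.
Proof.
by move=> a x y; apply: subspace_val_inj; rewrite -[LHS]/(banach_val _)
  -[RHS]/(banach_val _) !linearP.
Qed.

HB.instance Definition _ := GRing.isLinear.Build K (banach_type hA)
  (banach_type hB) *:%R banach_incl banach_incl_linear.

Lemma banach_incl_inj : injective banach_incl.
Proof. by move=> x y [xy]; exact: subspace_val_inj. Qed.

End Inclusion.

Section Val.
Variables (B : set E) (hB : banach_disk B) (t : lc_topology E).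

Definition banach_lcs (x : banach_type hB) : lcs t := banach_val x.

Fact banach_lcs_linear : linear banach_lcs.
Proof. by move=> a x y; rewrite /banach_lcs linearP. Qed.

HB.instance Definition _ := GRing.isLinear.Build K (banach_type hB)
  (lcs t) *:%R banach_lcs banach_lcs_linear.

Lemma banach_lcs_continuous : tvs_bounded t B -> continuous banach_lcs.
Proof.
move=> bB; apply/(normed_linear_continuousP banach_lcs) => U /nbhs0E.
move=> /nbhs0_absolutely_convex[V [tV VU cV]].
have [r r0 Br] := (tvs_boundedP _ _).1 bB V tV cV.
have [[B0 cB _] _] := hB.
exists r^-1 => [|x]; first by rewrite invr_gt0.
rewrite banach_normE ltr_rs => /(gauge_lt cB B0 (banach_valP x)).
move=> /(dilateS Br); rewrite dilate_dilate mulVf ?gt_eqF// dilate1.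
exact: VU.
Qed.

End Val.

Lemma banach_incl_continuous (A B : set E) (hA : banach_disk A)
    (hB : banach_disk B) (AB : A `<=` B) :
  continuous (@banach_incl _ _ hA hB (lspanS AB)).
Proof.
apply/(normed_linear_continuousP (@banach_incl _ _ hA hB (lspanS AB))) => U.
move=> /nbhs_ballP[_ /pos_realP[e e0 ->] eU].
have [[A0 cA _] _] := hA.
exists e => // x; rewrite banach_normE ltr_rs => xe; apply: eU.
rewrite -ball_normE/= sub0r normrN banach_normE ltr_rs banach_val_incl.
apply: le_lt_trans xe; apply/ler_addgt0Pl => d d0.
apply: gauge_le; first by rewrite ltr_pwDl// gauge_ge0.
apply: (dilateS AB); apply: gauge_lt => //; first exact: banach_valP.
by rewrite ltrDr.
Qed.

End BanachInclusion.

Section InductiveLB.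
Context {R : realType} {k : base_field} {E : lmodType (base_scalars R k)}.
Local Notation K := (base_scalars R k).
Local Notation rs := (@real_scalar R k).
Variables (D : nat -> set E) (hD : forall n, banach_disk (D n)).
Hypothesis DS : forall n, D n `<=` D n.+1.
Hypothesis Dcover : forall x, exists n, lspan (D n) x.

Let t := inductive_topology D.
Local Notation F n := (banach_type (hD n)).
Let i n : {linear F n -> F n.+1} :=
  @banach_incl _ _ _ _ _ (hD n) (hD n.+1) (lspanS (@DS n)).
Let j n : {linear F n -> lcs t} := @banach_lcs _ _ _ _ (hD n) t.

Let Dle n m : (n <= m)%N -> D n `<=` D m.
Proof. exact: increasing_subset. Qed.

Section Universal.
Variables (S : tvsType K) (g : forall n, {linear F n -> S}).
Hypothesis gc : forall n, continuous (g n).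
Hypothesis gi : forall n, g n.+1 \o i n = g n.

(** By induction on the later stage: a vector that already lives at the stage
    before can be pulled back there along the linking map, which [g]
    respects. *)
Let compat n m (z : F n) (w : F m) : banach_val z = banach_val w ->
  g n z = g m w.
Proof.
wlog nm : n m z w / (n <= m)%N => [h zw|].
  by have [nm|/ltnW mn] := leqP n m; [exact: h|apply/esym/h].
elim: m nm w => [|m IH] nm w zw.
  move: nm z zw; rewrite leqn0 => /eqP ->{n} z zw.
  by congr (g _ _); exact: subspace_val_inj.
move: nm; rewrite leq_eqVlt ltnS => /predU1P[nm|nm].
  case: _ / nm w zw => w zw; congr (g _ _); exact: subspace_val_inj.
have [w' w'z] := subspace_valK (lspan_subspace (D m))
  (lspanS (Dle nm) (banach_valP z)).
rewrite (IH nm w' (esym w'z)) -(gi m) /=; congr (g _ _).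
by apply: subspace_val_inj; rewrite -[RHS]/(banach_val w) -zw.
Qed.

Let lift x : exists y : S, forall n (z : F n), banach_val z = x -> g n z = y.
Proof.
have [n Dx] := Dcover x.
have [z zx] := subspace_valK (lspan_subspace (D n)) Dx.
exists (g n z) => m w wx; apply: compat; rewrite wx; exact: esym.
Qed.

(** The compatible maps [g n] glue to a linear map [h]. The preimage under [h]
    of an absolutely convex neighbourhood absorbs every [D n] by the
    continuity of [g n], and is therefore a neighbourhood. *)
Lemma inductive_universal : exists! h : lcs t -> S,
  [/\ linear h, continuous h & forall n, h \o j n = g n].
Proof.
have /choice[h hP] := lift.
have hg n (z : F n) : h (banach_val z) = g n z by exact/esym/hP.
have hl (a : K) x y : h (a *: x + y) = a *: h x + h y.
  have [n Dx] := Dcover x; have [m Dy] := Dcover y.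
  have Dx' := lspanS (Dle (leq_maxl n m)) Dx.
  have Dy' := lspanS (Dle (leq_maxr n m)) Dy.
  have [z <-] := subspace_valK (lspan_subspace (D (maxn n m))) Dx'.
  have [w <-] := subspace_valK (lspan_subspace (D (maxn n m))) Dy'.
  have := hg _ (a *: (z : F (maxn n m)) + w); rewrite linearP => ->.
  by rewrite linearP !(hg (maxn n m)).
have h0 : h 0 = 0.
  by have := hl (-1) 0 0; rewrite !scaleN1r !addNr.
have hD' : {morph h : x y / x + y}.
  by move=> x y; have := hl 1 x y; rewrite !scale1r.
have hZ (a : K) x : h (a *: x) = a *: h x.
  by have := hl a x 0; rewrite !addr0 h0 addr0.
exists h; split=> [|h' [_ _ h'j]]; last first.
  apply/funext => x; have [n Dx] := Dcover x.
  have [z <-] := subspace_valK (lspan_subspace (D n)) Dx.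
  by rewrite hg -h'j.
split=> [||n]; [exact: hl| |by apply/funext => z; exact: hg].
apply: (lcs_linear_continuous hD') => U.
move=> /tvs_nbhs0_absolutely_convex[W [nW WU cW]].
apply: (@filterS _ _ (nbhs0_filter t) (h @^-1` W)); first by move=> x /WU.
have cD n : absolutely_convex (D n) by case: (hD n) => -[].
have D0 n : D n !=set0 by case: (hD n) => -[].
apply: inductive_nbhs0 => //.
  by move=> a c x y ac Wx Wy; rewrite /preimage/= hD' !hZ; exact: cW.
move=> n; have [e e0 eW] := (normed_linear_continuousP (g n)).1 (@gc n) W nW.
exists (2 / e) => [|x Dx]; first by rewrite divr_gt0.
apply/dilateV; rewrite ?divr_gt0// invf_div /preimage/= hZ.
have [z zx] := subspace_valK (lspan_subspace (D n)) (sub_lspan Dx).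
rewrite -zx (hg n z) -linearZ; apply: eW; rewrite banach_normE ltr_rs.
have e2 : 0 < e / 2 by rewrite divr_gt0.
rewrite (@le_lt_trans _ _ (e / 2))//; last first.
  by rewrite ltr_pdivrMr// ltr_pMr// ltr1n.
rewrite linearZ/=; apply: gauge_le => //; exists x => //.
by rewrite -zx.
Qed.

End Universal.

Lemma inductive_LB_space : LB_space (lcs (inductive_topology D)).
Proof.
exists (fun n => banach_type (hD n) : completeNormedModType K), i, j; split.
  move=> n; split; first exact: banach_incl_inj.
  exact: banach_incl_continuous.
split.
- by move=> n; apply: banach_lcs_continuous; exact: inductive_bounded.
- by [].
- by move=> S g gc gi; exact: inductive_universal.
Qed.

End InductiveLB.

(** * LB-spaces are inductive limits of complete disks *)

Section Corestriction.
Context {K : numFieldType} {E F : lmodType K}.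
Variables (P : set E) (lP : linear_subspace P) (f : {linear F -> E}).
Hypothesis fP : forall x, P (f x).

Definition corestrict (x : F) : subspace_type lP :=
  exist _ (f x) (mem_set (fP x)).

Fact corestrict_linear : linear corestrict.
Proof.
move=> a x y; apply: subspace_val_inj.
by rewrite linearP /subspace_val/= linearP.
Qed.

HB.instance Definition _ := GRing.isLinear.Build K F (subspace_type lP) *:%R
  corestrict corestrict_linear.

End Corestriction.

Section IndiscreteTopology.
Context {R : realType} {k : base_field} (E : lmodType (base_scalars R k)).

(** Maps into this space are continuous; it reduces colimits of topological
    vector spaces to colimits of vector spaces. *)
Definition indiscrete : lc_topology E := inductive_topology (fun=> setT).

Lemma indiscrete_nbhs0 U : nbhs0 indiscrete U -> U = setT.
Proof.
move=> [V [VU cV /(_ 0%N)/(absorbsP cV)[r r0 TV] _]].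
apply/seteqP; split=> // x _; apply: VU.
have /TV/dilateV : [set: E] (real_scalar k r *: x) by [].
by rewrite scalerA -rmorphM mulVf ?gt_eqF// rmorph1 scale1r; apply.
Qed.

Lemma indiscrete_continuous (T : topologicalType) (f : T -> lcs indiscrete) :
  continuous f.
Proof.
move=> x U; rewrite -[nbhs (f @ x) U]/(nbhs x (f @^-1` U)).
rewrite nbhs_lcsE => /indiscrete_nbhs0 UT.
apply: filterE => y /=; have : [set u : E | U (f x + u)] (f y - f x).
  by rewrite UT.
by rewrite /= addrC subrK.
Qed.

End IndiscreteTopology.

Section LBInductive.
Context {R : realType} {k : base_field} {E : lmodType (base_scalars R k)}.
Local Notation K := (base_scalars R k).
Local Notation rs := (@real_scalar R k).
Variable t : lc_topology E.

(** The maps [j n] corestrict to the union [P] of their images, so that they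
    factor through a map [h] into [P]. Followed by the inclusion, [h]
    satisfies the same conditions as the identity, hence is the identity by
    uniqueness. *)
Lemma colimit_cover (F : nat -> completeNormedModType K)
    (i : forall n, {linear F n -> F n.+1})
    (j : forall n, {linear F n -> lcs t}) :
  @tvs_colimit _ (fun n => F n) i (lcs t) j ->
  forall x : E, exists n z, j n z = x.
Proof.
move=> [jc ji univ].
have jiE n z : j n.+1 (i n z) = j n z by have /(congr1 (@^~ z)) := ji n.
have up n m (z : F n) : (n <= m)%N -> exists w, j m w = j n z.
  move=> /subnKC <-; elim: (m - n)%N => [|p [w wz]].
    by rewrite addn0; exists z.
  by rewrite addnS; exists (i _ w); rewrite -wz jiE.
pose P : set E := [set x | exists n z, j n z = x].
have lP : linear_subspace P.
  split=> [|a x y [n [z <-]] [m [w <-]]].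
    by exists 0%N, 0; rewrite linear0.
  have [z' <-] := up n (maxn n m) z (leq_maxl _ _).
  have [w' <-] := up m (maxn n m) w (leq_maxr _ _).
  by exists (maxn n m), (a *: z' + w'); rewrite linearP.
have jP n z : P (j n z) by exists n, z.
pose g n : {linear F n -> lcs (indiscrete (subspace_type lP))} :=
  corestrict lP (jP n).
have [||h [[hl _ hj] _]] := univ _ g.
- by move=> n; exact: indiscrete_continuous.
- by move=> n; apply/funext => z; apply: subspace_val_inj; exact: jiE.
have [||h' [_ uniq]] := univ (lcs (indiscrete E)) j.
- by move=> n; exact: indiscrete_continuous.
- exact: ji.
have h'id : h' = id.
  by apply: uniq; split=> //; exact: indiscrete_continuous.
pose vh (x : lcs t) : lcs (indiscrete E) := @subspace_val _ _ P lP (h x).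
have h'vh : h' = vh.
  apply: uniq; split.
  - by move=> a x y; rewrite /vh hl linearP.
  - exact: indiscrete_continuous.
  - move=> n; apply/funext => z; rewrite /vh/=.
    by have /(congr1 (@^~ z)) /= -> := hj n.
move=> x; have /(congr1 (@^~ x)) /= -> : id = _ := etrans (esym h'id) h'vh.
exact: (@subspace_valP _ _ P lP (h x)).
Qed.

(** The disk [D n] is the image of the ball of radius [c n], where the radii
    absorb the norms of the linking maps and make the sequence increasing. The
    universal property applied to the inductive topology of [D] yields a
    continuous map which, as [D] covers the space, is the identity. *)
Lemma LB_space_inductive : LB_space (lcs t) -> exists D : nat -> set E,
  [/\ [/\ forall n, absolutely_convex (D n), forall n, D n !=set0,
          forall n, fast_complete (D n) & forall n, D n `<=` D n.+1],
      forall x, exists n, lspan (D n) x & t = inductive_topology D].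
Proof.
move=> [F [i [j [ic colim]]]]; have cover := colimit_cover colim.
have [jc ji univ] := colim.
have jiE n z : j n.+1 (i n z) = j n z by have /(congr1 (@^~ z)) := ji n.
have /choice[M MP] n : exists M : R, 0 < M /\ forall (c : R) (x : F n), 0 < c ->
    `|x| <= rs c -> `|i n x| <= rs (M * c).
  have [_ /(normed_linear_continuousP (i n))] := ic n.
  move=> /(_ (ball 0 1) (nbhsx_ballx _ _ ltr01))[e e0 eP].
  exists (2 / e); split=> [|c x c0 xc]; first by rewrite divr_gt0.
  have d0 : 0 < e / 2 / c by rewrite !divr_gt0.
  have := eP (rs (e / 2 / c) *: x).
  rewrite normrZ norm_rs gtr0_norm// -ball_normE/= sub0r normrN linearZ normrZ.
  rewrite norm_rs gtr0_norm// => h.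
  rewrite -(ler_pM2l (_ : 0 < rs (e / 2 / c))) ?rs_gt0// -rmorphM.
  have -> : e / 2 / c * (2 / e * c) = 1.
    by field; rewrite !gt_eqF.
  rewrite rmorph1 ltW// h// -ltr_pdivlMl ?rs_gt0// (le_lt_trans xc)//.
  rewrite -fmorphV -rmorphM ltr_rs invf_div.
  have -> : c / (e / 2) * e = 2 * c by field; rewrite gt_eqF.
  by rewrite ltr_pMl// ltr1n.
pose c := fix c n := if n is m.+1 then M m * c m else 1.
have c0 n : 0 < c n.
  by elim: n => [|n IH] //=; rewrite mulr_gt0//; exact: (MP n).1.
pose D n : set E := j n @` [set x : F n | `|x| <= rs (c n)].
have cD n : absolutely_convex (D n).
  move=> a b _ _ ab [x xc <-] [y yc <-]; exists (a *: x + b *: y).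
    by have := closed_ball_absolutely_convex (ltW (c0 n)) ab xc yc.
  by rewrite linearD !linearZ.
have D0 n : D n !=set0.
  by exists (j n 0), 0; rewrite //= normr0 rs_ge0 ltW.
have fD n : fast_complete (D n).
  exact: (@fast_complete_image _ _ (F n) E (j n) _
    (closed_ball_fast_complete (c0 n))).
have DS n : D n `<=` D n.+1.
  move=> _ [x xc <-]; exists (i n x); last exact: jiE.
  by apply: (MP n).2 => //.
have Dball n (z : F n) r : 0 < r -> `|z| <= rs (r * c n) ->
    dilate r (D n) (j n z).
  move=> r0 zr; apply/dilateV => //.
  exists (rs r^-1 *: z); last by rewrite linearZ.
  rewrite /= normrZ norm_rs gtr0_norm ?invr_gt0// fmorphV.
  by rewrite ler_pdivrMl ?rs_gt0// -rmorphM.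
have Dcover x : exists n, lspan (D n) x.
  have [n [z <-]] := cover x; exists n; apply/lspanP => //.
  have [r r0 zr] := norm_realP `|z|; rewrite normr_id in zr.
  have r1 : 0 < r + 1 by rewrite ltr_wpDl.
  exists ((r + 1) / c n); first by rewrite divr_gt0.
  apply: Dball; first by rewrite divr_gt0.
  by rewrite divfK ?gt_eqF// zr ler_rs lerDl.
exists D; split=> //; apply: lc_topology_ext; apply/seteqP; split=> U.
  move=> /nbhs0_absolutely_convex[V [tV VU cV]].
  apply: (@filterS _ _ (nbhs0_filter _) V) => //.
  apply: inductive_nbhs0 => // n.
  have [e e0 eV] :=
    (normed_linear_continuousP (j n)).1 (jc n) V ((nbhs0E _ _).2 tV).
  have ec : 0 < 2 * c n / e by rewrite divr_gt0// mulr_gt0.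
  exists (2 * c n / e) => // _ [x xc <-]; apply/dilateV => //.
  rewrite -[_ *: _]linearZ; apply: eV.
  rewrite normrZ norm_rs gtr0_norm ?invr_gt0//.
  rewrite fmorphV ltr_pdivrMl ?rs_gt0// (le_lt_trans xc)// -rmorphM ltr_rs.
  by rewrite divfK ?gt_eqF// ltr_pMl// ltr1n.
pose g n : {linear F n -> lcs (inductive_topology D)} := j n.
have gc n : continuous (g n).
  apply/(normed_linear_continuousP (g n)) => V.
  move=> /nbhs0E/nbhs0_absolutely_convex[W [tW WV cW]].
  have [r r0 Dr] := (tvs_boundedP _ _).1 (inductive_bounded n) W tW cW.
  exists (c n / r) => [|x xc]; first by rewrite divr_gt0.
  apply: WV; rewrite -[W]dilate1 -[1](mulVf (lt0r_neq0 r0)) -dilate_dilate.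
  apply: (dilateS Dr); apply: Dball; first by rewrite invr_gt0.
  by rewrite mulrC ltW.
have gi n : g n.+1 \o i n = g n := ji n.
have [h [[_ hc hj] _]] := univ (lcs (inductive_topology D)) g gc gi.
have hid x : h x = x.
  by have [n [z <-]] := cover x; have /(congr1 (@^~ z)) := hj n.
move=> /(nbhs0E _ _).2 U0; have /hc/nbhs0E : nbhs (h 0) U by rewrite hid.
by apply: (@filterS _ _ (nbhs0_filter _)) => x; rewrite /preimage/= hid.
Qed.

End LBInductive.

(** * The characterization *)

Section Characterization.
Context {R : realType} {k : base_field} {E : lmodType (base_scalars R k)}.
Local Notation K := (base_scalars R k).
Local Notation rs := (@real_scalar R k).
Implicit Types (t : lc_topology E) (b : convex_bornology E) (A B : set E).

Lemma bornology_dilate b A B r : A `<=` dilate r B -> b B -> b A.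
Proof. by move=> AB /(bornologyZ (rs r)); exact: bornologyS. Qed.

Lemma sumset_absolutely_convex A B :
  absolutely_convex A -> absolutely_convex B ->
  absolutely_convex [set x + y | x in A & y in B].
Proof.
move=> cA cB a c _ _ ac [x Ax [y By <-]] [z Az [w Bw <-]].
exists (a *: x + c *: z); first exact: cA.
exists (a *: y + c *: w); first exact: cB.
by rewrite !scalerDr addrACA.
Qed.

Lemma hausdorff_separation t e : hausdorff_space (lcs t) -> e != 0 ->
  exists f : {scalar E}, f e != 0 /\ forall A, tvs_bounded t A ->
    exists M, forall x, A x -> `|f x| <= rs M.
Proof.
move=> /lcs_hausdorffP ht e0; have [U tU nUe] := ht e e0.
have [V [tV VU cV]] := nbhs0_absolutely_convex tU.
have [|f [fe fV]] := 
    @disk_separation _ _ _ V e cV (fun x => nbhs0_absorbs_point x tV).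
  by move/VU; exact: nUe.
exists f; split=> // A /tvs_boundedP/(_ V tV cV)[r r0 Ar].
exists (r * 2) => x /Ar[v Vv <-].
rewrite linearZ normrM norm_rs (gtr0_norm r0) rmorphM.
by rewrite ler_pM2l ?rs_gt0//; exact: fV.
Qed.

(** The Banach disks are those of the inductive sequence and the pre-Banach
    disks are their closures; bounded sets are then described by
    [inductive_bounded_sub], and closures may be taken in [t] throughout
    because [t] is finer than [(E, b)^ub] and coarser than [(E, b)^t]. *)
Lemma LB_bornology_disks t : hausdorff_space (lcs t) -> LB_space (lcs t) ->
  let b := bornology_of_topology t in
  exists Bh B : nat -> set E,
    [/\ forall n, banach_disk_in b (Bh n),
        forall n, pre_banach_disk_in b (B n),
        [set: E] = \bigcup_n lspan (Bh n) /\ born_colimit b B,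
        functionals_separate B & closures_bounded b B].
Proof.
move=> ht /LB_space_inductive[D [[cD D0 fD DS] Dcover tD]] b.
have lb : line_free b := hausdorff_line_free ht.
have bD n : b (D n) by rewrite /b tD; exact: inductive_bounded.
have banachD n : banach_disk_in b (D n).
  split=> //; split; first exact: (line_free_norming lb (bD n)).
  exact: fast_complete_disk.
pose B n : set E := closure (D n : set (lcs t)).
have DB n : D n `<=` B n by exact: sub_closure.
have cB n : absolutely_convex (B n) by exact: closure_absolutely_convex.
have B0 n : B n !=set0 by have [x Dx] := D0 n; exists x; exact: DB.
have bB n : b (B n) by apply: tvs_bounded_closure; exact: bD.
have BS n : B n `<=` B n.+1 by apply: (@closureS (lcs t)); exact: DS.
exists D, B; split=> //.
- move=> n; split=> //; first exact: (line_free_norming lb (bB n)).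
  exists (D n); split=> //; apply: closure_nbhsS => U.
  move=> /nbhs0_absolutely_convex[V [ubV VU cV]].
  apply: (@filterS _ _ (nbhs0_filter _) _ _ VU); rewrite tD.
  apply: inductive_nbhs0 => // m.
  have := ultrabornologification_continuous (banachD m).
  by move=> /disk_inclusion_continuousP; apply.
- split.
    by apply/seteqP; split=> // x _; have [n] := Dcover x; exists n.
  split.
  + by move=> n; apply: lspanS; exact: BS.
  + move=> n A /disk_boundedP[]// r r0 Ar; apply/disk_boundedP => //.
    by exists r => //; exact: subset_trans (dilateS (@BS n)).
  + apply/seteqP; split=> // x _; have [n Dx] := Dcover x.
    by exists n => //; exact: lspanS Dx.
  + move=> A; split=> [bA|[n /disk_boundedP[]// r r0 Ar]].
      have [|n An] := @inductive_bounded_sub _ _ _ D cD D0 Dcover DS A.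
        by rewrite -tD.
      exists n; apply/disk_boundedP => //; exists n.+1%:R => //.
      by rewrite /B tD.
    exact: bornology_dilate Ar (bB n).
- move=> e /(hausdorff_separation ht)[f [fe fb]]; exists f; split=> // n.
  by apply: fb; exact: bB.
- move=> n; exists n => //; apply/disk_boundedP => //; exists 1 => //.
  rewrite dilate1; have tb : nbhs0 t `<=` nbhs0 (topology_of_bornology b).
    move=> U /nbhs0_absolutely_convex[V [tV VU cV]]; exists V; split=> // A bA.
    by apply: bA; exact/nbhs0E.
  apply: (subset_trans (closure_nbhsS tb)).
  by rewrite -((closure_id _).1 (@closed_closure _ _)).
Qed.

Section DisksToLB.
Variables (b : convex_bornology E) (Bh C B : nat -> set E).
Hypothesis banachBh : forall n, banach_disk_in b (Bh n).
Hypothesis banachC : forall n, banach_disk_in b (C n).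
Hypothesis normB : forall n, norming_disk (B n).
Hypothesis BC : forall n,
  B n `<=` closure (C n : set (lcs (ultrabornologification b))).
Hypothesis Bhcover : forall x, exists n, lspan (Bh n) x.
Hypothesis bE : forall A, b A <-> exists n, disk_bounded (B n) A.
Hypothesis Bsep : functionals_separate B.
Hypothesis Bclosure : closures_bounded b B.

Let cB n : absolutely_convex (B n). Proof. by case: (normB n). Qed.
Let B0 n : B n !=set0. Proof. by case: (normB n). Qed.

Let fbounded (f : {scalar E}) :
  (forall n, exists M : R, forall x, B n x -> `|f x| <= rs M) ->
  forall A, b A -> exists2 M, 0 < M & forall x, A x -> `|f x| <= rs M.
Proof.
move=> fB A /bE[n /disk_boundedP[]// r r0 Ar].
have [M fM] := fB n; exists (r * `|M| + 1).
  by rewrite ltr_wpDl// mulr_ge0// ltW.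
move=> x /Ar[y By <-]; rewrite linearZ normrM norm_rs (gtr0_norm r0).
rewrite rmorphD rmorphM ler_wpDr ?rs_ge0// ler_pM2l ?rs_gt0//.
by rewrite (le_trans (fM _ By))// ler_rs ler_norm.
Qed.

Let lb : line_free b.
Proof.
move=> A x bA Ax; apply/eqP; apply: contrapT => /negP x0.
have [f [fx /fbounded/(_ _ bA)[M M0 fM]]] := Bsep x0.
have [s s0 fs] : exists2 s : R, 0 < s & `|f x| = rs s.
  by have := @pos_realP R k `|f x|; rewrite normr_gt0 => /(_ fx).
have [n] := small_half M s0; apply/negP; rewrite -leNgt.
rewrite ler_pdivlMr ?exprn_gt0//; have := fM _ (Ax n).
rewrite linearZ normrM norm_rs (ger0_norm (exprn_ge0 _ _))// fs -rmorphM.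
by rewrite ler_rs mulrC.
Qed.

(** Adding [Bh n] makes the disks cover the space, and adding [C n] makes the
    sets [B n] bounded. *)
Let G n : set E := [set x + y | x in Bh n & y in C n].

Let D := fix D n : set E :=
  if n is m.+1 then [set x + y | x in D m & y in G m.+1] else G 0%N.

Let banach_fast A : banach_disk_in b A ->
  [/\ absolutely_convex A, A 0, fast_complete A & b A].
Proof.
move=> [[[A0 cA _] compA] bA]; split=> //; first exact: absolutely_convex0.
exact: disk_complete_fast.
Qed.

Let sum_fast A A' : [/\ absolutely_convex A, A 0, fast_complete A & b A] ->
  [/\ absolutely_convex A', A' 0, fast_complete A' & b A'] ->
  let S := [set x + y | x in A & y in A'] in
  [/\ absolutely_convex S, S 0, fast_complete S & b S].
Proof.
move=> [cA A0 fA bA] [cA' A'0 fA' bA']; split.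
- exact: sumset_absolutely_convex.
- by exists 0 => //; exists 0 => //; rewrite addr0.
- exact: fast_completeD.
- exact: bornologyD.
Qed.

Let GP n : [/\ absolutely_convex (G n), G n 0, fast_complete (G n) & b (G n)].
Proof. by apply: sum_fast; exact: banach_fast. Qed.

Let DP n : [/\ absolutely_convex (D n), D n 0, fast_complete (D n) & b (D n)].
Proof.
by elim: n => [|n IH]; [exact: GP|exact: (sum_fast IH (GP n.+1))].
Qed.

Let DS n : D n `<=` D n.+1.
Proof.
move=> x Dx; exists x => //; exists 0; last by rewrite addr0.
by have [] := GP n.+1.
Qed.

Let GD n : G n `<=` D n.
Proof.
case: n => [//|n] x Gx; exists 0; last by exists x; rewrite ?add0r.
by have [] := DP n.
Qed.

Let BhD n : Bh n `<=` D n.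
Proof.
move=> x Bx; apply: GD; exists x => //; exists 0; last by rewrite addr0.
by have [] := banach_fast (banachC n).
Qed.

Let CD n : C n `<=` D n.
Proof.
move=> x Cx; apply: GD; exists 0; last by exists x; rewrite ?add0r.
by have [] := banach_fast (banachBh n).
Qed.

Let cD n : absolutely_convex (D n). Proof. by case: (DP n). Qed.
Let D0 n : D n !=set0. Proof. by exists 0; case: (DP n). Qed.
Let fD n : fast_complete (D n). Proof. by case: (DP n). Qed.
Let bD n : b (D n). Proof. by case: (DP n). Qed.

Let Dcover x : exists n, lspan (D n) x.
Proof. by have [n Bx] := Bhcover x; exists n; exact: lspanS (@BhD n) _ Bx. Qed.

Let banachD n : banach_disk (D n).
Proof.
split; first exact: (line_free_norming lb (bD n)).
exact: fast_complete_disk.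
Qed.

Let t := inductive_topology D.

(** By the factorization theorem every Banach disk of [b] is absorbed by some
    [D n], hence by the neighbourhoods of [0] in [t]. *)
Let t_ub : nbhs0 t `<=` nbhs0 (ultrabornologification b).
Proof.
apply: ultrabornologification_finest => A banachA.
have [[[A0 cA _] _] bA] := banachA; have [_ _ fA _] := banach_fast banachA.
apply/disk_inclusion_continuousP => // V tV cV.
have [n [r r0 Ar]] :=
  grothendieck_factorization lb bA cA A0 fA bD cD D0 fD DS Dcover.
have [s s0 Ds] := (tvs_boundedP _ _).1 (inductive_bounded (D := D) n) V tV cV.
exists (r * s); first exact: mulr_gt0.
by rewrite -dilate_dilate; apply: (subset_trans Ar); exact: dilateS.
Qed.

Let bt_t : nbhs0 (topology_of_bornology b) `<=` nbhs0 t.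
Proof.
move=> U [V [VU cV bV]]; apply: (@filterS _ _ (nbhs0_filter t) _ _ VU).
by apply: inductive_nbhs0 => // n; apply/absorbsP => //; exact: bV.
Qed.

Let t_hausdorff : hausdorff_space (lcs t).
Proof.
apply/lcs_hausdorffP => x x0; have [f [fx /fbounded fb]] := Bsep x0.
have [s s0 fs] : exists2 s : R, 0 < s & `|f x| = rs s.
  by have := @pos_realP R k `|f x|; rewrite normr_gt0 => /(_ fx).
have s2 : 0 < s / 2 by rewrite divr_gt0.
exists [set y | `|f y| <= rs (s / 2)]; last first.
  rewrite /= fs ler_rs; apply/negP; rewrite -ltNge.
  by rewrite ltr_pdivrMr// ltr_pMr// ltr1n.
apply: inductive_nbhs0 => // [a c y z ac /= fy fz|n].
  rewrite linearD !linearZ /= (le_trans (ler_normD _ _))// !normrM.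
  rewrite -[leRHS]mul1r (le_trans _ (ler_wpM2r _ ac)) ?rs_ge0 ?(ltW s2)//.
  by rewrite mulrDl lerD// ler_wpM2l.
have [M M0 fM] := fb _ (bD n); exists (M / (s / 2)); first exact: divr_gt0.
move=> y Dy; apply/dilateV; first exact: divr_gt0.
have Ms : 0 < (M / (s / 2))^-1 by rewrite invr_gt0 divr_gt0.
rewrite /= linearZ normrM norm_rs (gtr0_norm Ms).
rewrite fmorphV ler_pdivrMl ?rs_gt0 ?divr_gt0// -rmorphM.
by rewrite divfK ?gt_eqF//; exact: fM.
Qed.

Let t_bornology : b = bornology_of_topology t.
Proof.
apply: bornology_ext => A; split=> [/bE[n /disk_boundedP[]// r r0 Ar]|bA].
  apply: (bornology_dilate Ar).
  apply: (bornologyS (subset_trans (@BC n) (closure_nbhsS t_ub))).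
  apply: tvs_bounded_closure.
  apply: (@bornologyS _ _ (bornology_of_topology t) _ _ (@CD n)).
  exact: inductive_bounded.
have [n An] := inductive_bounded_sub cD D0 Dcover DS bA.
apply: (bornology_dilate An).
have [m /disk_boundedP[]// r r0 Dr] := (bE _).1 (bD n).
have [p _ Bp] := Bclosure m.
have bcl : b (closure (B m : set (lcs (topology_of_bornology b)))).
  by apply/bE; exists p.
apply: bornology_dilate bcl; apply: (subset_trans (@closureS (lcs t) _ _ Dr)).
apply: (subset_trans (closure_dilate r0)); apply: dilateS.
exact: closure_nbhsS.
Qed.

(** The topology is the inductive topology of the partial sums of [Bh i + C
    i]. *)
Lemma disks_LB_bornology : exists t : lc_topology E,
  [/\ hausdorff_space (lcs t), LB_space (lcs t) & b = bornology_of_topology t].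
Proof.
exists t; split=> //.
exact: (inductive_LB_space banachD DS Dcover).
Qed.

End DisksToLB.

End Characterization.

Theorem theorem3p9 (R : realType) (k : base_field)
    (E : lmodType (base_scalars R k)) (b : convex_bornology E) :
  (exists t : lc_topology E,
    [/\ hausdorff_space (lcs t), LB_space (lcs t) &
        b = bornology_of_topology t])
  <->
  (exists Bh B : nat -> set E,
    [/\ forall n, banach_disk_in b (Bh n),
        forall n, pre_banach_disk_in b (B n),
        [set: E] = \bigcup_n lspan (Bh n) /\ born_colimit b B,
        functionals_separate B &
        closures_bounded b B]).
Proof.
split=> [[t [ht LBt ->]]|]; first exact: LB_bornology_disks.
move=> [Bh [B [banachBh preB [cover [_ _ _ bE]] sepB clB]]].
have /choice[C CP] n : exists C, banach_disk_in b C /\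
    B n `<=` closure (C : set (lcs (ultrabornologification b))).
  by have [_ _ [C [banachC _ BC]]] := preB n; exists C.
apply: (@disks_LB_bornology R k E b Bh C B) => //.
- by move=> n; exact: (CP n).1.
- by move=> n; have [_] := preB n.
- by move=> n; exact: (CP n).2.
- by move=> x; have : [set: E] x by []; rewrite cover => -[n _]; exists n.
Qed.
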